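(* Let $S$ be a shift of finite type on $\mathbb{Z}$. There exist constants $c,C\in(0,\infty)$ depending on $S$ such that the following hold. (i) If $S$ is non-lattice then there exists an ffiid process $X$ such that $X\in S$ almost surely, with coding radius $R$ satisfying $$\mathbb{P}(R>r)\leq \frac{1}{\operatorname{tower}(cr)}\qquad\text{for all } r>0.$$ (ii) If $S$ contains no constant configuration $(\cdots aaa\cdots)$, then for any ffiid process $X$ such that $X\in S$ almost surely, the coding radius $R$ satisfies $$\mathbb{P}(R>r)\geq \frac{1}{\operatorname{tower}(Cr)}\qquad\text{for all } r>0.$$
   Context: Write $[q]=\{1,\dots,q\}$. A shift of finite type on $\mathbb{Z}$ is a set of the form $$S=S(q,k,W)=\{x\in[q]^{\mathbb{Z}}:(x_{i+1},\dots,x_{i+k})\in W\ \ \forall i\in\mathbb{Z}\}$$ for positive integers $q,k$ and a set $W\subseteq[q]^k$. For $w\in W$, let $T(w)$ be the set of $t\geq 1$ for which there exists $x\in S$ with $(x_1,\dots,x_k)$ and $(x_{t+1},\dots,x_{t+k})$ both equal to $w$. $S$ is non-lattice if there exists $w\in W$ for which $T(w)$ has greatest common divisor $1$. A process $X=(X_i)_{i\in\mathbb{Z}}$ is ffiid (a finitary factor of an iid process) if $X=F(Y)$ for some family $Y=(Y_i)_{i\in\mathbb{Z}}$ of iid random variables (with values in an arbitrary measurable space) and some measurable map $F$ that commutes with every translation of $\mathbb{Z}$, such that for almost every $y$ (with respect to the law of $Y$) there exists $r<\infty$ such that whenever $y'$ agrees with $y$ on $\{-r,\dots,r\}$ we have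 $F(y')_0=F(y)_0$. The minimum such non-negative integer $r$ is denoted $R(y)$, and $R=R(Y)$ is the coding radius. For a non-negative integer $r$, $\operatorname{tower}(r)=\exp\cdots\exp 1$ with $\exp$ iterated $r$ times (so $\operatorname{tower}(0)=1$); for real $r\geq 0$, $\operatorname{tower}(r)=\operatorname{tower}(\lfloor r\rfloor)$. *)

(* Defs.v *)
From HB Require Import structures.
From mathcomp Require Export all_boot all_order all_algebra.
From mathcomp Require Export all_classical all_reals all_analysis.
From mathcomp Require Export measurable_realfun.

Set Implicit Arguments.
Unset Strict Implicit.
Unset Printing Implicit Defensive.

Import Order.TTheory GRing.Theory Num.Theory.

Local Open Scope classical_set_scope.
Local Open Scope ring_scope.

Section ShiftOfFiniteType.
Variables q k : nat.

(* The alphabet {1, ..., q} is represented by 'I_q. *)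
Implicit Types (x : int -> 'I_q) (W : {set k.-tuple 'I_q}).

(* (x_{i+1}, ..., x_{i+k}) *)
Definition window x (i : int) : k.-tuple 'I_q :=
  [tuple x (i + (j.+1)%:Z) | j < k].

Definition shift_ft W : set (int -> 'I_q) :=
  [set x | forall i, window x i \in W].

Definition return_times W (w : k.-tuple 'I_q) : set nat :=
  [set t | (1 <= t)%N /\
           exists x, [/\ shift_ft W x, window x 0 = w & window x t%:Z = w]].

Definition is_gcd (T : set nat) (g : nat) : Prop :=
  (forall t, T t -> g %| t)%N /\
  (forall d : nat, (forall t, T t -> d %| t) -> d %| g)%N.

Definition non_lattice W : Prop :=
  exists2 w, w \in W & is_gcd (return_times W w) 1.

Definition has_constant W : Prop :=
  exists a : 'I_q, shift_ft W (fun=> a).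

End ShiftOfFiniteType.

(* The generators of the product sigma-algebra on int -> T, when T carries the
   sigma-algebra G. *)
Definition cylinders (T : Type) (G : set (set T)) : set (set (int -> T)) :=
  \bigcup_(i in [set: int])
    preimage_set_system [set: int -> T] (fun y => y i) G.

Definition path_space (d : measure_display) (B : measurableType d) :=
  g_sigma_algebraType (cylinders (@measurable _ B)).

Section Tower.
Variable R : realType.

Definition tower_nat (n : nat) : R := iter n expR 1.

Definition tower (x : R) : R := tower_nat (Num.truncn x).

End Tower.

Section FactorMap.
Variables (d : measure_display) (B : measurableType d) (q : nat).
Variable F : (int -> B) -> (int -> 'I_q).

(* On [q]^Z the sigma-algebra is the product of the discrete ones. *)
Definition measurable_map : Prop :=
  forall E : set (int -> 'I_q), <<s cylinders [set: set 'I_q] >> E ->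
    measurable (F @^-1` E : set (path_space B)).

Definition translate (T : Type) (n : int) (y : int -> T) : int -> T :=
  fun i => y (i + n).

Definition translation_equivariant : Prop :=
  forall (n : int) (y : int -> B), F (translate n y) = translate n (F y).

Definition determined_within (y : int -> B) (r : nat) : Prop :=
  forall y' : int -> B, (forall i : int, `|i| <= r%:Z -> y' i = y i) ->
    F y' 0 = F y 0.

(* The least r such that [determined_within y r], and +oo if there is none. *)
Definition coding_radius (R : realType) (y : int -> B) : \bar R :=
  ereal_inf [set (r%:R)%:E | r in determined_within y].

End FactorMap.

Section Process.
Variables (R : realType) (dO dB : measure_display).
Variables (Omega : measurableType dO) (P : probability Omega R).
Variable B : measurableType dB.
Implicit Types (Y : int -> {RV P >-> B}).

Definition mutually_independent Y : Prop :=
  forall (s : seq int) (A : int -> set B),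
    uniq s -> (forall i, measurable (A i)) ->
    P (\bigcap_(i in [set` s]) (Y i @^-1` A i)) =
    (\prod_(i <- s) P (Y i @^-1` A i))%E.

Definition identically_distributed Y : Prop :=
  forall (i j : int) (A : set B), measurable A ->
    distribution P (Y i) A = distribution P (Y j) A.

Definition iid Y : Prop := mutually_independent Y /\ identically_distributed Y.

Definition path Y (w : Omega) : path_space B := fun i => Y i w.

Definition law Y : set (path_space B) -> \bar R := pushforward P (path Y).

Definition finitary (q : nat) Y (F : (int -> B) -> (int -> 'I_q)) : Prop :=
  {ae law Y, forall y, exists r : nat, determined_within F y r}.

Definition ffiid (q : nat) Y (F : (int -> B) -> (int -> 'I_q))
    (X : Omega -> int -> 'I_q) : Prop :=
  [/\ iid Y, measurable_map F, translation_equivariant F, finitary Y F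
    & forall w, X w = F (path Y w)].

Definition radius (q : nat) Y (F : (int -> B) -> (int -> 'I_q))
    (w : Omega) : \bar R :=
  coding_radius F R (path Y w).

(* For an arbitrary factor map over an arbitrary measurable space B, the event
   {R > r} is defined through an uncountable quantification over B^Z and need
   not be measurable.  The lower bound P(A) >= p is therefore read as a bound on
   the inner probability of A; for measurable A nothing changes. *)
Definition prob_ge (A : set Omega) (p : R) : Prop :=
  exists D : set Omega, [/\ measurable D, D `<=` A & (p%:E <= P D)%E].

Lemma prob_geE (A : set Omega) (p : R) :
  measurable A -> prob_ge A p <-> (p%:E <= P A)%E.
Proof.
move=> mA; split=> [[D [mD DA pD]]|pA]; last by exists A; split.
by apply: (le_trans pD); apply: le_measure; rewrite ?inE.
Qed.

End Process.

(* Main.v *)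
From HB Require Import structures.
Require Import Defs.
From mathcomp Require Import ring lra zify.
Import Order.TTheory GRing.Theory Num.Theory.
Local Open Scope classical_set_scope.
Local Open Scope ring_scope.
Set Implicit Arguments.
Unset Strict Implicit.
Unset Printing Implicit Defensive.

(** Why the theorem is true.

    Lower bound.  Let [n] be the integer part of [r].  Overwrite the coordinates
    of [y] outside [-n, n] by [y 0]: where the coding radius is at most [n] this
    does not change the letter at the origin.  The letters read off after
    overwriting form a process each of whose letters is a function of [2n + 1]
    consecutive iid variables, and such processes cannot avoid repetitions: by a
    Ramsey argument ([block_collision]) a function of [r] consecutive iid variables
    with finitely many values agrees with its translate with probability at least
    one over a tower of height [r] plus a constant.  For the [k]-tuples of
    consecutive letters an agreement is a run of equal letters of length [k + 1].
    As no word (a, ..., a) belongs to [W], such a run contains a letter that the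
    overwriting has changed, so that the overwriting changes the letter at the
    origin with at least that probability divided by [k]
    ([inner_radius_lower_bound]).  For [r < 1] the bound to prove is 1; if the
    letter at the origin were a function of [y 0] on an event of positive
    probability, then the same letter would occupy [k] consecutive sites with
    positive probability ([inner_radius_positive]).

    Upper bound.  Let [w] be a word whose return times have gcd 1.  Return times
    form an additive semigroup, hence contain all large integers, and it suffices
    to select a random set of sites, the markers, whose consecutive gaps lie in
    [t0, 2 t0): put [w] after each marker and fill each gap by a fixed admissible
    word of its length ([word_in_W]).

    The markers are found greedily in stages.  In stage [s] every site gets a
    colour from a fixed finite set by the Cole-Vishkin reduction: labels of
    [label_size S] random bits, where [label_size] grows like a tower, become
    colours below 16 after [S] rounds, and neighbours keep distinct colours as long
    as their labels differ ([cole_vishkin_proper]).  The colour classes are then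
    swept one after the other; a site becomes a marker if no marker is closer than
    [t0] and no other site closer than [t0] shares its colour.  A site is left
    undecided by stage [s] only if two of linearly many labels coincide, which has
    probability at most [K * S / 2 ^ label_size S] ([prob_rule_none]), while stage
    [s] looks at distance linear in [s] only.  Once a neighbourhood is decided it
    never changes, so the letters of all stages are consistent.

    The exact coding radius of this factor would be defined through a quantification
    over uncountably many configurations.  To make it equal to the explicit stopping
    time of the procedure, and therefore measurable, the procedure also stops at the
    first site on the right that carries one of two signals, labels of probability
    zero, and then outputs a letter naming the signal: before it stops, the two
    signals lead to different letters ([determinedP]). *)

(** * The path space and its product laws *)

Section PathSpace.
Context d (B : measurableType d).

Lemma measurable_coord (i : int) :
  measurable_fun setT (fun y : path_space B => y i).
Proof.
move=> _ A mA; rewrite setTI; apply: sub_sigma_algebra.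
by exists i => //; exists A => //; rewrite setTI.
Qed.

(** The coordinate events generate the sigma-algebra of the path space. *)
Lemma measurable_to_path d' (T : measurableType d') (f : T -> path_space B) :
  (forall i, measurable_fun setT (fun t => f t i)) -> measurable_fun setT f.
Proof.
move=> mf; apply: (@measurability _ _ _ (path_space B) setT f (cylinders measurable)) => //.
move=> _ [_ [i _ [A mA <-]] <-]; rewrite setTI.
by have := mf i measurableT A mA.
Qed.

Lemma measurable_translate (n : int) :
  measurable_fun setT (translate n : path_space B -> path_space B).
Proof. by apply: measurable_to_path => i; exact: measurable_coord. Qed.

Definition rect (A : int -> set B) : set (path_space B) :=
  [set y | forall i, A i (y i)].

(** Requiring [A i = setT] off [s] makes a rectangle determined by [A] alone, so that
    rectangles intersect coordinatewise. *)
Definition rects : set (set (path_space B)) :=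
  [set E | exists s A, [/\ uniq s, forall i, measurable (A i),
     forall i, i \notin s -> A i = setT & E = rect A]].

Lemma measurable_rect A : (forall i, measurable (A i)) -> measurable (rect A).
Proof.
move=> mA; have -> : rect A = \bigcap_i ((fun y : path_space B => y i) @^-1` A i).
  by apply/seteqP; split=> [y Ay i _|y Ay i]; [exact: Ay | exact: (Ay i)].
rewrite -[X in measurable X]setCK setC_bigcap; apply: measurableC.
apply: countable_bigcupT_measurable => // i; apply: measurableC.
by rewrite -[X in measurable X]setTI; exact: measurable_coord.
Qed.

Lemma rects_setI : setI_closed rects.
Proof.
move=> _ _ [s [A [us mA As ->]]] [t [A' [ut mA' At ->]]].
exists (undup (s ++ t)), (fun i => A i `&` A' i); split.
- exact: undup_uniq.
- by move=> i; exact: measurableI.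
- by move=> i; rewrite mem_undup mem_cat negb_or => /andP[/As-> /At->]; rewrite setIT.
- by apply/seteqP; split=> [y [? ?] i|y yA]; [split | split=> i; case: (yA i)].
Qed.

Lemma rects_generate : @measurable _ (path_space B) = <<s rects >>.
Proof.
apply/seteqP; split; apply: smallest_sub; try exact: smallest_sigma_algebra.
- move=> _ [i _ [A mA <-]]; apply: sub_sigma_algebra.
  exists [:: i], (fun j => if j == i then A else setT); split=> //.
  + by move=> j; case: ifP.
  + by move=> j; rewrite inE => /negPf->.
  + rewrite setTI; apply/seteqP; split=> [y Ay j|y /(_ i)]; last by rewrite eqxx.
    by case: eqP => // ->.
- by move=> _ [s [A [_ mA _ ->]]]; exact: measurable_rect.
Qed.

Lemma path_measure_unique (R : realType)
    (m1 m2 : {measure set (path_space B) -> \bar R}) :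
  (m1 setT < +oo)%E -> (forall E, rects E -> m1 E = m2 E) ->
  forall E, measurable E -> m1 E = m2 E.
Proof.
move=> foo m12 E mE; apply: (measure_unique rects (fun=> setT)) => //.
- exact: rects_generate.
- exact: rects_setI.
- move=> _; exists [::], (fun=> setT); split=> //.
  by apply/seteqP; split.
- by rewrite bigcup_const.
Qed.

Definition set_coord (i : int) (y : path_space B) (b : B) : path_space B :=
  fun j => if j == i then b else y j.

Lemma measurable_set_coord i :
  measurable_fun setT (fun yb : path_space B * B => set_coord i yb.1 yb.2).
Proof.
apply: measurable_to_path => j; rewrite /set_coord; case: (j == i).
  exact: measurable_snd.
by apply: (measurableT_comp (measurable_coord j)); exact: measurable_fst.
Qed.

Lemma measurable_set_coord_section i y (E : set (path_space B)) :
  measurable E -> measurable [set b | E (set_coord i y b)].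
Proof.
have mu : measurable_fun setT (set_coord i y).
  apply: measurable_to_path => j; rewrite /set_coord; case: (j == i) => //.
by move=> mE; rewrite -[X in measurable X]setTI; exact: mu.
Qed.

End PathSpace.

Section ProductLaw.
Context d (B : measurableType d) (R : realType).
Variables (L : probability (path_space B) R) (mu : probability B R).

(** The law of an iid sequence with marginal [mu]. *)
Definition product_law := forall (s : seq int) (A : int -> set B),
  uniq s -> (forall i, measurable (A i)) ->
  L [set y | forall i, i \in s -> A i (y i)] = (\prod_(i <- s) mu (A i))%E.

Hypothesis Lprod : product_law.

Lemma law_rect s A : uniq s -> (forall i, measurable (A i)) ->
  (forall i, i \notin s -> A i = setT) -> L (rect A) = (\prod_(i <- s) mu (A i))%E.
Proof.
move=> us mA As; rewrite -Lprod//; congr (L _).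
apply/seteqP; split=> [y Ay i _|y Ay i]; first exact: Ay.
by have [/Ay//|/As->] := boolP (i \in s).
Qed.

Lemma law_translate n (E : set (path_space B)) :
  measurable E -> L (translate n @^-1` E) = L E.
Proof.
pose tr : {mfun path_space B >-> path_space B} :=
  mfun_Sub (mem_set (@measurable_translate _ B n)).
move=> mE; apply: (@path_measure_unique _ _ _ (distribution L tr)) => //.
  by rewrite ltey_eq fin_num_measure.
move=> _ [s [A [us mA As ->]]].
rewrite [RHS](law_rect us mA As) /distribution /pushforward /=.
transitivity (L (rect (fun i => A (i - n)))).
  congr (L _); apply/seteqP; split=> y Ay i.
    by have := Ay (i - n); rewrite /= /translate subrK.
  by have := Ay (i + n); rewrite /= addrK.
rewrite (@law_rect [seq i + n | i <- s]) //.
- by rewrite big_map; apply: eq_bigr => i _; rewrite addrK.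
- by rewrite map_inj_uniq//; exact: addIr.
- move=> i; have -> : (i \in [seq j + n | j <- s]) = (i - n \in s); last exact: As.
  by rewrite -{1}[i](subrK n) (mem_map (@addIr _ n)).
Qed.

(** The law of [y] with its [i]-th coordinate redrawn from [mu] gives every rectangle
    the same product as [L] does, so it is [L]: this is Fubini for one coordinate
    against all others. *)
Lemma law_resample i (E : set (path_space B)) : measurable E ->
  L E = (\int[L]_y mu [set b | E (set_coord i y b)])%E.
Proof.
pose up : {mfun (path_space B * B)%type >-> path_space B} :=
  mfun_Sub (mem_set (@measurable_set_coord _ B i)).
pose LM := @product_subprobability _ _ _ _ R ((L : subprobability _ R), (mu : subprobability _ R)).
move=> mE; transitivity (pushforward LM up E).
  apply: path_measure_unique => //; first by rewrite ltey_eq fin_num_measure.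
  move=> _ [s [A [us mA As ->]]].
  transitivity ((L \x mu)%E ((rect (fun j => if j == i then setT else A j)) `*` A i)); last first.
    rewrite /pushforward; congr ((L \x mu)%E _); apply/esym/seteqP.
    split=> [[y b]/= Ay|[y b] /= [Ay Ab] j].
      split; last by have := Ay i; rewrite /set_coord eqxx.
      by move=> j; have := Ay j; rewrite /set_coord; case: eqP.
    by rewrite /set_coord; case: eqP => [->//|/eqP/negPf ji]; have := Ay j; rewrite ji.
  transitivity (L (rect (fun j => if j == i then setT else A j)) * mu (A i))%E; last first.
    by rewrite product_measure1E//; apply: measurable_rect => j; case: eqP.
  have mA' j : measurable (if j == i then setT else A j) by case: ifP.
  have As' j : j \notin rem i s -> (if j == i then setT else A j) = setT.
    by rewrite mem_rem_uniq// !inE negb_and negbK; case: eqP => //= _ /As.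
  rewrite [LHS](law_rect us mA As) (law_rect (rem_uniq _ us) mA' As').
  have [si|si] := boolP (i \in s).
    rewrite (perm_big _ (perm_to_rem si))/= big_cons muleC; congr (_ * _)%E.
    rewrite big_seq [RHS]big_seq; apply: eq_bigr => j.
    by rewrite mem_rem_uniq// !inE; case: eqP.
  rewrite rem_id// (As _ si) probability_setT mule1.
  rewrite big_seq [RHS]big_seq; apply: eq_bigr => j js.
  by case: eqP => // ji; rewrite -ji js in si.
rewrite /pushforward /= /LM /product_subprobability /= /product_measure1.
apply: eq_integral => y _ /=; congr (mu _).
by apply/seteqP; split=> b; rewrite /xsection /= inE.
Qed.

Lemma measurable_resample i (E : set (path_space B)) : measurable E ->
  measurable_fun setT (fun y => mu [set b | E (set_coord i y b)]).
Proof.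
move=> mE.
have mE' : measurable ((fun yb : path_space B * B => set_coord i yb.1 yb.2) @^-1` E).
  by rewrite -[X in measurable X]setTI; exact: measurable_set_coord.
apply: eq_measurable_fun (measurable_fun_xsection mu mE') => y _ /=.
by congr (mu _); apply/seteqP; split=> b; rewrite /xsection /= inE.
Qed.

Lemma measurable_set_coord_preimage i (E : set (path_space B)) : measurable E ->
  measurable [set yb : path_space B * B | E (set_coord i yb.1 yb.2)].
Proof.
by move=> mE; rewrite -[X in measurable X]setTI; exact: (@measurable_set_coord _ B i).
Qed.

(** The same identity, integrating first over the configuration; it controls the
    letter at the origin when [y 0] is known. *)
Lemma law_resample_swap i (E : set (path_space B)) : measurable E ->
  L E = (\int[mu]_b L [set y | E (set_coord i y b)])%E.
Proof.
move=> mE; rewrite (law_resample i mE).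
pose E2 := [set yb : path_space B * B | E (set_coord i yb.1 yb.2)].
have mE2 : measurable E2 by exact: measurable_set_coord_preimage.
transitivity ((L \x mu)%E E2).
  apply: eq_integral => y _; congr (mu _).
  by apply/seteqP; split=> b; rewrite /xsection /= inE.
transitivity ((L \x^ mu)%E E2).
  by apply: product_measure_unique => //= ? ? ? ?; rewrite product_measure2E.
apply: eq_integral => b _; congr (L _).
by apply/seteqP; split=> y; rewrite /ysection /= inE.
Qed.

Lemma measurable_resample_swap i (E : set (path_space B)) : measurable E ->
  measurable_fun setT (fun b => L [set y | E (set_coord i y b)]).
Proof.
move=> mE; have mE2 := measurable_set_coord_preimage i mE.
apply: eq_measurable_fun (measurable_fun_ysection L mE2) => b _ /=.
by congr (L _); apply/seteqP; split=> y; rewrite /ysection /= inE.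
Qed.

End ProductLaw.

(** * Finite unions and maps into finite types *)

(** By induction on [s], peeling off [E i] from [A]. *)
Lemma union_bound d (T : measurableType d) (R : realType)
    (m : {measure set T -> \bar R}) (I : eqType) (s : seq I)
    (E : I -> set T) (A : set T) :
  (forall i, i \in s -> measurable (E i)) -> measurable A ->
  (forall x, A x -> exists2 i, i \in s & E i x) ->
  (m A <= \sum_(i <- s) m (E i))%E.
Proof.
elim: s A => [|j s IH] A mE mA AE.
  rewrite big_nil (_ : A = set0) ?measure0//.
  by apply/seteqP; split=> // x /AE[].
rewrite big_cons; have mEj : measurable (E j) by apply: mE; rewrite mem_head.
have mD : measurable (A `\` E j) by exact: measurableD.
apply: (@le_trans _ _ (m (E j `|` (A `\` E j)))).
  by rewrite le_measure ?inE//; [exact: measurableU | rewrite setUDr setDv setD0; exact: subsetUr].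
apply: (le_trans (measureU2 _ _ _)) => //; rewrite leeD2l//.
apply: IH => // [i si|x [Ax Ejx]]; first by apply: mE; rewrite inE si orbT.
by have [i] := AE _ Ax; rewrite inE => /orP[/eqP-> //|]; exists i.
Qed.

(** For countable [T] this is measurability for the discrete sigma-algebra. *)
Definition fiber_measurable d (S : measurableType d) (T : Type) (f : S -> T) :=
  forall a, measurable (f @^-1` [set a]).

Section FiberMeasurable.
Context d (S : measurableType d).

Lemma fiber_measurable_set (T : finType) (f : S -> T) (Q : T -> Prop) :
  fiber_measurable f -> measurable [set y | Q (f y)].
Proof.
move=> mf; rewrite (_ : [set y | _] = \bigcup_(a in Q) f @^-1` [set a]).
  by apply: fin_bigcup_measurable => //; exact: finite_finset.
by apply/seteqP; split=> [y Qy|y [a Qa /= ->]//]; exists (f y).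
Qed.

Lemma fiber_measurable_comp (T T' : finType) (f : S -> T) (h : T -> T') :
  fiber_measurable f -> fiber_measurable (h \o f).
Proof. by move=> mf a; apply: (@fiber_measurable_set _ f (fun t => h t = a)). Qed.

Lemma fiber_measurable_ffun (I T : finType) (f : I -> S -> T) :
  (forall i, fiber_measurable (f i)) -> fiber_measurable (fun y => [ffun i => f i y]).
Proof.
move=> mf a; rewrite (_ : _ @^-1` _ = \bigcap_(i in [set: I]) f i @^-1` [set a i]).
  by apply: fin_bigcap_measurable => // i _; exact: mf.
apply/seteqP; split=> [y ya i _|y ya]; first by rewrite /= -(ya : _ = a) ffunE.
by apply/ffunP => i; rewrite ffunE; exact: ya.
Qed.

Lemma fiber_measurable_pair (T T' : finType) (f : S -> T) (f' : S -> T') :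
  fiber_measurable f -> fiber_measurable f' -> fiber_measurable (fun y => (f y, f' y)).
Proof.
move=> mf mf' [a a']; rewrite (_ : _ @^-1` _ = f @^-1` [set a] `&` f' @^-1` [set a']).
  exact: measurableI.
by apply/seteqP; split=> y /=; [case=> -> -> | case=> -> ->].
Qed.

End FiberMeasurable.

Lemma fiber_measurable_pre d d' (S : measurableType d) (S' : measurableType d')
    (T : Type) (f : S' -> T) (g : S -> S') :
  fiber_measurable f -> measurable_fun setT g -> fiber_measurable (f \o g).
Proof.
by move=> mf mg a; rewrite comp_preimage -[X in measurable X]setTI; exact: mg.
Qed.

(** * Collisions of block factors *)

(** The number [x] below a stack of [r] exponentials in base 2. *)
Fixpoint tower2 (r x : nat) : nat := if r is r'.+1 then (2 ^ tower2 r' x)%N else x.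

Lemma tower2_out r x : tower2 r (2 ^ x) = (2 ^ tower2 r x)%N.
Proof. by elim: r => //= r ->. Qed.

Lemma leq_tower2 r x y : (x <= y)%N -> (tower2 r x <= tower2 r y)%N.
Proof. by elim: r => //= r IH /IH; rewrite leq_exp2l. Qed.

Lemma tower2_ge r x : (x <= tower2 r x)%N.
Proof.
by elim: r => //= r IH; apply: (leq_trans IH); apply: ltnW; exact: ltn_expl.
Qed.

Lemma tower2_mul r a x : (0 < a)%N -> (0 < x)%N -> (a * tower2 r x <= tower2 r (a * x))%N.
Proof.
move=> a0 x0; elim: r => //= r IH; have t0 := leq_trans x0 (tower2_ge r x).
apply: (@leq_trans (2 ^ a.-1 * 2 ^ tower2 r x)).
  by rewrite leq_mul2r; case: a a0 {IH} => // a _; rewrite ltn_expl ?orbT.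
rewrite -expnD leq_exp2l//; apply: leq_trans IH; nia.
Qed.

Lemma tower2_sqr r x : (1 < x)%N -> (tower2 r x ^ 2 <= tower2 r (x ^ 2))%N.
Proof.
move=> x1; elim: r => //= r IH; have t1 := leq_trans x1 (tower2_ge r x).
by rewrite -expnM leq_exp2l//; apply: leq_trans IH; nia.
Qed.

(** One step of [block_collision] multiplies the inverse probability like this.  Any
    factor [c] with [4 * c ^ 2 * 2 ^ (3 * N) <= 2 ^ (c * N)] serves in place of 13,
    and [4 * 13 ^ 2 <= 2 ^ 10]. *)
Lemma tower2_rec r N : (0 < N)%N ->
  (4 * N * tower2 r (13 * 2 ^ N) ^ 2 <= tower2 r.+1 (13 * N))%N.
Proof.
move=> N0; have e0 : (0 < 2 ^ N)%N by rewrite expn_gt0.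
have e1 : (N < 2 ^ N)%N by exact: ltn_expl.
apply: (@leq_trans (4 * N * tower2 r ((13 * 2 ^ N) ^ 2))).
  by rewrite leq_mul2l tower2_sqr ?orbT//; lia.
apply: (leq_trans (tower2_mul _ _ _)); [lia | by rewrite sqrn_gt0; lia | ].
rewrite /= -tower2_out; apply: leq_tower2.
apply: (@leq_trans (2 ^ 10 * 2 ^ N * 2 ^ N * 2 ^ N)); first by move: (2 ^ N)%N e0 e1 => z; nia.
by rewrite -!expnD leq_exp2l//; lia.
Qed.

Section BlockCollision.
Context d (B : measurableType d) (R : realType).
Variables (L : probability (path_space B) R) (mu : probability B R).
Hypothesis Lprod : product_law L mu.

Lemma resample_le i (E : set (path_space B)) (e : R) : measurable E -> 0 <= e ->
  (forall y, (mu [set b | E (set_coord i y b)] <= e%:E)%E) -> (L E <= e%:E)%E.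
Proof.
move=> mE e0 He; rewrite (law_resample Lprod i mE).
apply: (@le_trans _ _ (\int[L]_y e%:E)%E).
  by apply: ge0_le_integral => //; exact: measurable_resample.
rewrite integral_cst// [X in (_ * X)%E](_ : _ = 1%E) ?mule1//.
exact: probability_setT.
Qed.

(** Integrate over [D] only in [law_resample]. *)
Lemma resample_ge i (E D : set (path_space B)) (e : R) :
  measurable E -> measurable D -> 0 <= e ->
  (forall y, D y -> (e%:E <= mu [set b | E (set_coord i y b)])%E) ->
  (e%:E * L D <= L E)%E.
Proof.
move=> mE mD e0 He; rewrite (law_resample Lprod i mE).
rewrite -[D in leLHS]setIT -integral_indic// -ge0_integralZl//; last first.
  by apply/measurable_EFinP; exact: measurable_indic.
apply: ge0_le_integral => //.
- by move=> y _; rewrite mule_ge0// lee_fin.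
- by apply/measurable_EFinP; apply: measurable_funM => //; exact: measurable_indic.
- exact: measurable_resample.
- move=> y _; rewrite indicE; case: (boolP (y \in D)) => [|_]; rewrite ?mule1 ?mule0//.
  by rewrite inE; exact: He.
Qed.

Definition block (T : Type) (r : nat) (f : path_space B -> T) :=
  forall y y', (forall i : int, 0 <= i < r%:Z -> y i = y' i) -> f y = f y'.

(** Linial's argument, for random labels.  Call a value [a] popular at [y] if redrawing
    the last coordinate gives [f] the value [a] with probability at least [e].  The set
    [g y] of popular values depends on one coordinate less, so by induction [g] agrees
    with its translate with probability at least [dl].  As [f y] is rarely unpopular,
    with probability at least [dl / 2] the value [f y] is popular at [y], hence at the
    translate of [y]; redrawing one more coordinate then makes the next value of [f]
    equal to [f y] with probability at least [e].  The number of values grows from [N]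
    to [2 ^ N] in each step, whence the tower. *)
Theorem block_collision r (T : finType) (f : path_space B -> T) :
  fiber_measurable f -> block r f ->
  ((tower2 r (13 * #|T|))%:R^-1%:E <= L [set y | f (translate 1 y) = f y])%E.
Proof.
elim: r T f => [|r IH] T f mf bf.
  have -> : [set y | f (translate 1 y) = f y] = setT.
    by apply/seteqP; split=> // y _; apply: bf => i; lia.
  rewrite [leRHS](_ : _ = 1%E) ?lee_fin; last exact: probability_setT.
  rewrite /= invf_le1 ?ler1n.
    by rewrite muln_gt0 /=; apply/card_gt0P; exists (f point).
  by rewrite ltr0n muln_gt0 /=; apply/card_gt0P; exists (f point).
set N := #|T|; have N0 : (0 < N)%N by apply/card_gt0P; exists (f point).
pose dl : R := (tower2 r (13 * 2 ^ N))%:R^-1.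
(* The unpopular values then have total probability at most dl / 2. *)
pose e : R := dl / (2 * N%:R).
have dl0 : 0 < dl by rewrite invr_gt0 ltr0n (leq_trans _ (tower2_ge _ _))// muln_gt0 expn_gt0.
have e0 : 0 < e by rewrite divr_gt0// mulr_gt0// ltr0n.
pose g (y : path_space B) : {ffun T -> bool} :=
  [ffun a => (e%:E <= mu [set b | f (set_coord r y b) = a])%E].
have mg : fiber_measurable g.
  apply: fiber_measurable_ffun => a c.
  have mh := measurable_resample mu r (mf a).
  have mge : measurable [set y | (e%:E <= mu [set b | f (set_coord r y b) = a])%E].
    by rewrite -[X in measurable X]setTI; exact: emeasurable_fun_c_infty.
  case: c.
    rewrite (_ : _ @^-1` _ = [set y | (e%:E <= mu [set b | f (set_coord r y b) = a])%E])//.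
  rewrite (_ : _ @^-1` _ = ~` [set y | (e%:E <= mu [set b | f (set_coord r y b) = a])%E]).
    exact: measurableC.
  by apply/seteqP; split=> y /= /negP; [|move=> /negPf].
have bg : block r g.
  move=> y y' yy'; apply/ffunP => a; rewrite !ffunE; congr (_ <= mu _)%E.
  apply/seteqP; split=> b /= <-; apply: bf => i ir; rewrite /set_coord; case: eqP => // /eqP ni;
    rewrite yy'//; lia.
have mtr : measurable_fun setT (translate 1 : path_space B -> path_space B).
  exact: measurable_translate.
have g_set_coord y b : g (set_coord r y b) = g y.
  by apply: bg => i ir; rewrite /set_coord; case: eqP => // ?; lia.
have IHg := IH _ g mg bg; rewrite card_ffun card_bool -/N -/dl in IHg.
pose U : set (path_space B) := [set y | ~~ g y (f y)].
have mU : measurable U.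
  exact: (@fiber_measurable_set _ _ ({ffun T -> bool} * T)%type _ 
    (fun p => ~~ p.1 p.2) (fiber_measurable_pair mg mf)).
have LU : (L U <= (N%:R * e)%:E)%E.
  apply: (@resample_le r) => //; first by rewrite mulr_ge0// ltW.
  move=> y; pose E a := [set b | ~~ g y a /\ f (set_coord r y b) = a].
  have mfa a : measurable [set b | f (set_coord r y b) = a].
    exact: (@measurable_set_coord_section _ _ _ _ (f @^-1` [set a])).
  have mE a : measurable (E a).
    rewrite (_ : E a = if ~~ g y a then [set b | f (set_coord r y b) = a] else set0); last first.
      by rewrite /E; case: ifP => ga; apply/seteqP; split=> b //= -[].
    by case: ifP.
  apply: (@le_trans _ _ (\sum_(a <- enum T) mu (E a))%E).
    apply: union_bound => //; first exact: measurable_set_coord_section.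
    by move=> b /=; rewrite /U /= g_set_coord => gb; exists (f (set_coord r y b)); rewrite ?mem_enum.
  apply: (@le_trans _ _ (\sum_(a <- enum T) e%:E)%E); last first.
    by rewrite big_enum /= sumEFin sumr_const mulr_natl.
  apply: lee_sum => a _; have [ga|/negPn ga] := boolP (~~ g y a); last first.
    rewrite (_ : E a = set0) ?measure0 ?lee_fin ?ltW//.
    by apply/seteqP; split=> b // -[]; rewrite ga.
  have := ga; rewrite ffunE -ltNge => /ltW; apply: le_trans; apply: le_measure; rewrite ?inE//.
  by move=> b [].
pose V : set (path_space B) := [set y | g (translate 1 y) = g y /\ g y (f y)].
have mV : measurable V.
  exact: (@fiber_measurable_set _ _ ({ffun T -> bool} * ({ffun T -> bool} * T))%type _
    (fun p => p.1 = p.2.1 /\ p.2.1 p.2.2)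
    (fiber_measurable_pair (fiber_measurable_pre mg mtr) (fiber_measurable_pair mg mf))).
have LV : (((dl / 2)%:E) <= L V)%E.
  pose G : set (path_space B) := [set y | g (translate 1 y) = g y].
  have mG : measurable G.
    exact: (@fiber_measurable_set _ _ ({ffun T -> bool} * {ffun T -> bool})%type _
      (fun p => p.1 = p.2) (fiber_measurable_pair (fiber_measurable_pre mg mtr) mg)).
  have VU : (L G <= L V + L U)%E.
    apply: le_trans (measureU2 _ _ _) => //; apply: le_measure; rewrite ?inE//.
      exact: measurableU.
    by move=> y /= gy; have [?|] := boolP (g y (f y)); [left | right].
  have := le_trans IHg VU.
  rewrite -[L V]fineK ?fin_num_measure// -[L U]fineK ?fin_num_measure//.
  move: LU; rewrite -[L U]fineK ?fin_num_measure// -EFinD !lee_fin /e.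
  have -> : N%:R * (dl / (2 * N%:R)) = dl / 2 by field; rewrite pnatr_eq0 -lt0n.
  lra.
pose C : set (path_space B) := [set y | f (translate 1 y) = f y].
have mC : measurable C.
  exact: (@fiber_measurable_set _ _ (T * T)%type _ (fun p => p.1 = p.2)
    (fiber_measurable_pair (fiber_measurable_pre mf mtr) mf)).
(* Redraw coordinate r + 1, the last one that the translate of f reads. *)
have LE : (e%:E * L V <= L C)%E.
  apply: (@resample_ge r.+1%:Z) => //; last 1 first.
  - move=> y [gg gf]; have : g (translate 1 y) (f y) by rewrite gg.
    rewrite ffunE => /le_trans; apply; apply: le_measure; rewrite ?inE.
      exact: (@measurable_set_coord_section _ _ _ _ (f @^-1` [set f y])).
      exact: (@measurable_set_coord_section _ _ _ _ _ mC).
    move=> b /= fb; rewrite /C /= (_ : f (set_coord _ _ _) = f y).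
      rewrite -fb; apply: bf => i ir; rewrite /translate /set_coord; congr (if _ then _ else _).
      by apply/eqP/eqP; lia.
    by apply: bf => i ir; rewrite /set_coord; case: eqP => // ?; lia.
  - exact: ltW.
apply: le_trans LE; apply: (@le_trans _ _ (e * (dl / 2))%:E); last first.
  by rewrite EFinM lee_pmul2l.
rewrite lee_fin.
have -> : e * (dl / 2) = (4 * N%:R * (tower2 r (13 * 2 ^ N))%:R ^+ 2)^-1.
  rewrite /e /dl; field; rewrite !pnatr_eq0 -!lt0n N0 /=.
  by rewrite andbT -(@ltr0n R) -invr_gt0.
rewrite lef_pV2 ?posrE; last 2 first.
- by rewrite ltr0n (leq_trans _ (tower2_ge _ _))// muln_gt0.
- by rewrite mulr_gt0 ?exprn_gt0 ?mulr_gt0 ?ltr0n// -(@ltr0n R) -invr_gt0.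
by rewrite -natrX -!natrM ler_nat; exact: tower2_rec.
Qed.

End BlockCollision.

(** * The lower bound on the coding radius *)

Section LowerBound.
Context (R : realType) (dO dB : measure_display) (Omega : measurableType dO)
  (P : probability Omega R) (B : measurableType dB).
Variable Y : int -> {RV P >-> B}.

Lemma measurable_path : measurable_fun setT (path Y).
Proof. by apply: measurable_to_path => i; exact: (@measurable_funPT _ _ _ _ (Y i)). Qed.

Definition path_law : probability (path_space B) R :=
  distribution P (mfun_Sub (mem_set measurable_path)).

Lemma path_lawE E : path_law E = P (path Y @^-1` E).
Proof. by []. Qed.

Lemma iid_product_law : iid Y -> product_law path_law (distribution P (Y 0)).
Proof.
move=> [indY idY] s A us mA; transitivity (\prod_(i <- s) P (Y i @^-1` A i))%E.
  by rewrite -indY.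
by apply: eq_bigr => i _; exact: (idY i 0 (A i) (mA i)).
Qed.

Variables (q k : nat) (W : {set k.-tuple 'I_q}).
Variables (F : (int -> B) -> (int -> 'I_q)).
Hypotheses (iidY : iid Y) (mF : measurable_map F) (eF : translation_equivariant F).
Hypothesis FW : {ae P, forall w, shift_ft W (F (path Y w))}.
Hypothesis noc : ~ has_constant W.

Let L := path_law.
Let mu : probability B R := distribution P (Y 0).
Let Lprod : product_law L mu := iid_product_law iidY.

Lemma F_translate m y : F y m = F (translate m y) 0.
Proof. by rewrite eF /translate add0r. Qed.

Lemma fiber_measurable_F0 : fiber_measurable (fun y : path_space B => F y 0).
Proof.
move=> a; apply: (mF (E := [set x | x 0 = a])); apply: sub_sigma_algebra.
by exists 0 => //; exists [set a] => //; rewrite setTI.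
Qed.

(** A constant run of length [k] is forbidden almost surely, so on [C] one of [k]
    consecutive sites must be in a translate of [D]. *)
Lemma constant_run_bound (m : int) (C D : set (path_space B)) :
  measurable C -> measurable D ->
  (forall y, C y -> exists a, forall j : 'I_k,
     ~ D (translate (m + j%:Z) y) -> F y (m + j%:Z) = a) ->
  (L C <= k%:R%:E * L D)%E.
Proof.
move=> mC mD CD; have [N [mN PN NW]] := FW.
have mp (E : set (path_space B)) : measurable E -> measurable (path Y @^-1` E).
  by move=> mE; rewrite -[X in measurable X]setTI; exact: measurable_path.
have mCN : measurable (path Y @^-1` C `\` N) by apply: measurableD => //; exact: mp.
have mDt j : measurable (translate (m + j%:Z) @^-1` D : set (path_space B)).
  by rewrite -[X in measurable X]setTI; exact: measurable_translate.
apply: (@le_trans _ _ (P (N `|` (path Y @^-1` C `\` N)))).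
  rewrite /L path_lawE; apply: le_measure; rewrite ?inE; [exact: mp | exact: measurableU |].
  by rewrite setUDr setDv setD0; exact: subsetUr.
apply: (le_trans (measureU2 _ _ _)) => //.
rewrite [X in (X + _)%E](_ : _ = 0%E) ?add0e; last exact: PN.
apply: (@le_trans _ _ (\sum_(j <- enum 'I_k)
    P (path Y @^-1` (translate (m + (j : 'I_k)%:Z) @^-1` D)))%E).
  apply: union_bound => //; first by move=> j _; exact: mp.
  move=> w [Cw Nw]; apply: contrapT => noD; apply: noc.
  have [a Fa] := CD _ Cw; exists a => i.
  have : window k (F (path Y w)) (m - 1) \in W.
    by have : shift_ft W (F (path Y w)) by apply: contrapT => /NW.
  suff -> : window k (F (path Y w)) (m - 1) = window k (fun=> a) i by [].
  apply: eq_from_tnth => j; rewrite !tnth_mktuple.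
  have -> : m - 1 + j.+1%:Z = m + j%:Z by lia.
  by apply: Fa => Dj; apply: noD; exists j; [rewrite mem_enum | exact: Dj].
have [e LDe] : exists e : R, L D = e%:E.
  by exists (fine (L D)); rewrite fineK ?fin_num_measure.
rewrite big_enum /= (eq_bigr (fun=> e%:E)) => [|j _]; last first.
  by transitivity (L D) => //; exact: (law_translate Lprod).
rewrite [leRHS](congr1 (fun z => k%:R%:E * z)%E LDe).
by rewrite sumEFin sumr_const card_ord -EFinM mulr_natl.
Qed.

(** Any overwriting that is a measurable function of the coordinates in [-n, n] would
    do; [y 0] avoids choosing a point of [B]. *)
Definition freeze n (y : path_space B) : path_space B :=
  fun i => if `|i| <= n%:Z then y i else y 0.

(** The witness is the event that freezing changes the letter at the origin.  It is
    measurable whatever [B] is, unlike the event that the radius exceeds [n]. *)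
Lemma inner_radius_lower_bound (n : nat) : (0 < k)%N -> exists D, [/\ measurable D,
    D `<=` [set w | ~ determined_within F (path Y w) n] &
    ((k * tower2 (n.*2 + k) (13 * q ^ k))%N%:R^-1%:E <= P D)%E].
Proof.
move=> k0; have mc : measurable_fun setT (freeze n).
  apply: measurable_to_path => i; rewrite /freeze; case: (`|i| <= n%:Z); exact: measurable_coord.
pose f y := F (freeze n y) 0.
have mf : fiber_measurable f := fiber_measurable_pre fiber_measurable_F0 mc.
pose D : set (path_space B) := [set y | f y <> F y 0].
have mD : measurable D.
  exact: (@fiber_measurable_set _ _ ('I_q * 'I_q)%type _ (fun p => p.1 <> p.2)
    (fiber_measurable_pair mf fiber_measurable_F0)).
pose Z (y : path_space B) := [ffun j : 'I_k => f (translate (n%:Z + j%:Z) y)].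
have mZ : fiber_measurable Z.
  by apply: fiber_measurable_ffun => j; apply: (fiber_measurable_pre mf); exact: measurable_translate.
have bZ : block (n.*2 + k) Z.
  move=> y y' yy'; apply/ffunP => j; rewrite !ffunE /f; congr (F _ 0).
  apply/funext => i; rewrite /freeze /translate; have := ltn_ord j => jk.
  by case: ifP => [ni|_]; apply: yy'; lia.
have := block_collision Lprod mZ bZ; rewrite card_ffun !card_ord.
pose C : set (path_space B) := [set y | Z (translate 1 y) = Z y].
have mC : measurable C.
  apply: (@fiber_measurable_set _ _ ({ffun 'I_k -> 'I_q} * {ffun 'I_k -> 'I_q})%type _
    (fun p => p.1 = p.2) (fiber_measurable_pair (fiber_measurable_pre mZ _) mZ)).
  exact: measurable_translate.
rewrite -/C => LC.
exists (path Y @^-1` D); split.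
- by rewrite -[X in measurable X]setTI; exact: measurable_path.
- move=> w /= fD det; apply: fD; apply: det => i ni.
  by rewrite /freeze ni.
have : (L C <= k%:R%:E * L D)%E.
  apply: (@constant_run_bound n%:Z) => // y Cy.
  exists (f (translate n%:Z y)) => j nD.
  rewrite F_translate; have [<-|/nD//] :=
    pselect (f (translate (n%:Z + j%:Z) y) = F (translate (n%:Z + j%:Z) y) 0).
  case: j {nD} => j jk /=; elim: j jk => [|j IH] jk; first by rewrite addr0.
  rewrite -IH; last exact: ltnW.
  have := congr1 (fun z : {ffun 'I_k -> 'I_q} => z (Ordinal (ltnW jk))) Cy.
  rewrite !ffunE /= => <-; congr f; apply/funext => i; rewrite /translate.
  by congr (y _); lia.
move=> /(le_trans LC).
have [e LDe] : exists e : R, L D = e%:E.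
  by exists (fine (L D)); rewrite fineK ?fin_num_measure.
rewrite -path_lawE -/L LDe -EFinM !lee_fin natrM invfM => le1.
by rewrite ler_pdivrMl ?ltr0n.
Qed.

(** Let [M a] be the set of [b] such that [y 0 = b] almost surely forces the letter [a].
    If [M a] had positive measure, then [k] consecutive coordinates would lie in [M a]
    with positive probability, by independence, and carry the letter [a].  A radius 0
    at [y] puts [y 0] into some [M a], even though the set of those [y] may not be
    measurable. *)
Lemma inner_radius_positive : (0 < k)%N -> exists D, [/\ measurable D,
    D `<=` [set w | ~ determined_within F (path Y w) 0] & P D = 1%E].
Proof.
move=> k0.
pose H a := [set y : path_space B | F y 0 = a].
have mH a : measurable (H a) := fiber_measurable_F0 a.
pose M a := [set b | L [set y | H a (set_coord 0 y b)] = 1%E].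
have mM a : measurable (M a).
  have mh := measurable_resample_swap L 0 (mH a).
  rewrite -[M a]setTI; exact: (mh measurableT _ (emeasurable_set1 1%E)).
have M0 a : mu (M a) = 0%E.
  pose D : set (path_space B) := [set y | M a (y 0) /\ F y 0 <> a].
  have mD : measurable D.
    apply: measurableI; last by apply: measurableC; exact: mH.
    by rewrite -[X in measurable X]setTI; exact: measurable_coord.
  have LD : L D = 0%E.
    rewrite (law_resample_swap Lprod 0 mD) integral0_eq// => b _.
    have [Mb|nMb] := pselect (M a b); last first.
      rewrite (_ : [set y | _] = set0) ?measure0//.
      by apply/seteqP; split=> // y []; rewrite /set_coord eqxx.
    have mHb : measurable [set y : path_space B | H a (set_coord 0 y b)].
      have mS : measurable_fun setT (fun y : path_space B => set_coord 0 y b).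
        apply: measurable_to_path => j; rewrite /set_coord; case: (j == 0) => //.
        exact: measurable_coord.
      by rewrite -[X in measurable X]setTI; apply: mS; rewrite //; exact: mH.
    rewrite (_ : [set y | _] = ~` [set y | H a (set_coord 0 y b)]).
      by rewrite probability_setC// [X in (_ - X)%E](_ : _ = 1%E)// subee.
    by apply/seteqP; split=> y; [case | split=> //; rewrite /set_coord eqxx].
  pose C := rect (fun i => if (0 <= i < k%:Z) then M a else setT).
  have mC : measurable C by apply: measurable_rect => i; case: ifP.
  have := @constant_run_bound 0 C D mC mD.
  rewrite LD mule0 measure_le0 => CD.
  have {CD}/eqP : L C == 0%E.
    apply: CD => y Cy; exists a => j nD; rewrite add0r in nD *.
    rewrite F_translate; apply: contrapT => Fa; apply: nD; split => //.
    by have := Cy j%:Z; rewrite /translate add0r /= ltz_nat ltn_ord.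
  rewrite (@law_rect _ _ _ _ _ Lprod [seq i%:Z | i <- iota 0 k]).
  - rewrite big_map big_seq (eq_bigr (fun=> mu (M a))) => [|i]; last first.
      by rewrite mem_iota add0n => /andP[_ ik]; rewrite lez_nat ltz_nat /= ik.
    rewrite -big_seq.
    have [e Me] : exists e : R, mu (M a) = e%:E.
      by exists (fine (mu (M a))); rewrite fineK ?fin_num_measure.
    rewrite Me prodEFin big_const_seq count_predT size_iota iter_mulr_1 => -[/eqP].
    by rewrite expf_eq0 k0 => /eqP->.
  - by rewrite map_inj_uniq ?iota_uniq// => i j [].
  - by move=> i; case: ifP.
  - move=> i; case: ifP => // ik /negP[]; apply/mapP; exists `|i|%N; last lia.
    by rewrite mem_iota; lia.
pose U := [set w | exists a, M a (Y 0 w)].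
have mYM a : measurable (Y 0 @^-1` M a).
  by rewrite -[X in measurable X]setTI; exact: (@measurable_funPT _ _ _ _ (Y 0)).
have mU : measurable U.
  rewrite (_ : U = \bigcup_(a in [set: 'I_q]) (Y 0 @^-1` M a)).
    by apply: fin_bigcup_measurable => // a _; exact: mYM.
  by apply/seteqP; split=> w [a]; [exists a | move=> _; exists a].
have PU : P U = 0%E.
  apply/eqP; rewrite -measure_le0.
  apply: (@le_trans _ _ (\sum_(a <- enum 'I_q) P (Y 0 @^-1` M a))%E).
    apply: union_bound => // w [a Ma]; exists a; [exact: mem_enum | exact: Ma].
  by rewrite big1// => a _; exact: M0.
exists (~` U); split; first exact: measurableC.
- move=> w /= nM det; apply: nM; exists (F (path Y w) 0).
  rewrite /M /= (_ : [set y | _] = setT) ?probability_setT//.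
  apply/seteqP; split=> // y _; apply: det => i i0.
  by have -> : i = 0 by lia.
- by rewrite probability_setC// PU sube0.
Qed.

End LowerBound.

Section TowerFacts.
Variable R : realType.

Lemma tower_nat_ge1 n : 1 <= tower_nat R n.
Proof.
rewrite /tower_nat; case: n => [|n] //=; rewrite (le_trans _ (expR_ge1Dx _))// lerDl.
by elim: n => //= n IH; exact: expR_ge0.
Qed.

Lemma tower_natS n : tower_nat R n.+1 = expR (tower_nat R n).
Proof. by []. Qed.

Lemma leq_tower_nat m n : (m <= n)%N -> tower_nat R m <= tower_nat R n.
Proof.
move=> /subnK <-; elim: (n - m)%N => // j IH; rewrite addSn tower_natS.
by apply: (le_trans IH); apply: le_trans (expR_ge1Dx _); rewrite lerDr.
Qed.

Lemma tower_nat_id n : n%:R <= tower_nat R n.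
Proof.
elim: n => [|n IH]; first by rewrite (le_trans _ (tower_nat_ge1 _)).
by rewrite tower_natS; apply: le_trans (expR_ge1Dx _); rewrite -natr1 addrC lerD2l.
Qed.

Lemma tower2_le r x m : x%:R <= tower_nat R m ->
  (tower2 r x)%:R <= tower_nat R (r + m).
Proof.
move=> xm; elim: r => [//|r IH]; rewrite addSn tower_natS [tower2 _ _]/=.
apply: le_trans (_ : expR (tower2 r x)%:R <= _); last by rewrite ler_expR.
rewrite natrX -[X in expR X]mul1r expRM_natr lerXn2r ?nnegrE ?expR_ge0//.
exact: (expR_ge1Dx 1).
Qed.

Lemma tower_ge1 x : 1 <= tower x :> R.
Proof. exact: tower_nat_ge1. Qed.

End TowerFacts.

Section Radius.
Context (R : realType) d (B : measurableType d) (q : nat)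
  (F : (int -> B) -> (int -> 'I_q)).

Lemma determined_leq y m n : (m <= n)%N ->
  determined_within F y m -> determined_within F y n.
Proof. by move=> mn dm y' yy'; apply: dm => i im; apply: yy'; lia. Qed.

(** A coding radius is a natural number or infinite, so only the integer part of [r]
    matters. *)
Lemma lt_coding_radius y (r : R) : 0 <= r ->
  (r%:E < coding_radius F R y)%E <-> ~ determined_within F y (Num.truncn r).
Proof.
move=> r0; split=> [rR dr|nd].
  have : (coding_radius F R y <= (Num.truncn r)%:R%:E)%E.
    by apply: ereal_inf_lbound; exists (Num.truncn r).
  by move=> /(lt_le_trans rR); rewrite lte_fin ltNge truncn_le r0.
apply: (@lt_le_trans _ _ (Num.truncn r).+1%:R%:E).
  by rewrite lte_fin truncnS_gt.
apply: le_ereal_inf_tmp => _ [m dm <-]; rewrite lee_fin ler_nat ltnNge.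
by apply/negP => /determined_leq/(_ dm).
Qed.

End Radius.

(** The collision lemma gives a tower of height [2n + k] over a constant [K]; as
    [n >= 1] as soon as [r >= 1], the additive constants are absorbed in [C * n]. *)
Lemma tower_lower_bound (R : realType) (q k : nat) (hq : (0 < q)%N) (hk : (0 < k)%N)
    (W : {set k.-tuple 'I_q}) : ~ has_constant W ->
  exists2 C : R, 0 < C &
    forall (dO dB : measure_display) (Omega : measurableType dO)
      (P : probability Omega R) (B : measurableType dB)
      (Y : int -> {RV P >-> B}) (F : (int -> B) -> (int -> 'I_q))
      (X : Omega -> int -> 'I_q),
      ffiid Y F X ->
      {ae P, forall w, shift_ft W (X w)} ->
      forall r : R, 0 < r ->
        prob_ge P [set w | (r%:E < radius Y F w)%E] (tower (C * r))^-1.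
Proof.
move=> noc; pose K := (k * (13 * q ^ k))%N; pose C := (2 + k + K)%N.
have C0 : (0 < C%:R :> R) by rewrite ltr0n.
exists C%:R => // dO dB Omega P B Y F X [iidY mF eF _ XF] XW r r0.
have FW : {ae P, forall w, shift_ft W (F (path Y w))}.
  by have [N [mN N0 NW]] := XW; exists N; split => // w /= nFw; apply: NW; rewrite /= XF.
have radE w : ~ determined_within F (path Y w) (Num.truncn r) -> (r%:E < radius Y F w)%E.
  by move=> nd; apply/lt_coding_radius => //; exact: ltW.
have [r1|r1] := ltP r 1.
  have [D [mD Dsub PD]] := inner_radius_positive iidY mF eF FW noc hk.
  exists D; split=> //; last by rewrite PD lee_fin invf_le1 ?tower_ge1// (lt_le_trans ltr01)// tower_ge1.
  move=> w /Dsub/= nd; apply: radE; suff -> : Num.truncn r = 0%N by [].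
  by apply: truncn_def; rewrite r1 ltW.
have [D [mD Dsub PD]] := inner_radius_lower_bound iidY mF eF FW noc (Num.truncn r) hk.
exists D; split=> // [w /Dsub/=|]; first exact: radE.
apply: le_trans PD; rewrite lee_fin lef_pV2 ?posrE; last 2 first.
- exact: lt_le_trans (tower_ge1 _).
- rewrite ltr0n muln_gt0 hk (leq_trans _ (tower2_ge _ _))// muln_gt0 expn_gt0 hq //.
set n := Num.truncn r; have n1 : (1 <= n)%N by rewrite truncn_gt0.
apply: (@le_trans _ _ (tower2 (n.*2 + k) K)%:R).
  by rewrite ler_nat; apply: tower2_mul => //; rewrite muln_gt0 expn_gt0 hq.
apply: (le_trans (tower2_le _ (tower_nat_id _ _))); apply: leq_tower_nat.
rewrite truncn_ge_nat; last by rewrite mulr_ge0// ltW.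
apply: (@le_trans _ _ (C * n)%:R); first by rewrite ler_nat /C; nia.
by rewrite natrM ler_pM2l// truncn_le ltW.
Qed.

(** * Return times and admissible words *)

Section NumericalSemigroup.

Lemma semigroup_mul (T : set nat) t n : (forall a b, T a -> T b -> T (a + b)%N) ->
  T t -> T (n.+1 * t)%N.
Proof.
by move=> Tadd Tt; elim: n => [|n IH]; rewrite ?mul1n// mulSn; exact: Tadd.
Qed.

(** The least positive difference [d] of two elements divides every element [n]:
    otherwise the remainder of [n] modulo [d] would be a smaller difference.  Hence
    [d = 1], and with [b] and [b + 1] in [T] every [t >= b ^ 2] is a combination of
    both, by Euclidean division by [b]. *)
Lemma semigroup_large (T : set nat) : (forall t, T t -> (0 < t)%N) ->
  (forall a b, T a -> T b -> T (a + b)%N) -> is_gcd T 1 ->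
  exists n0, forall t, (n0 <= t)%N -> T t.
Proof.
move=> Tpos Tadd [_ Tgcd].
have [t1 Tt1] : exists t, T t.
  apply: contrapT => nT; suff : (0 %| 1)%N by [].
  by apply: Tgcd => t Tt; case: nT; exists t.
pose D d := `[< (0 < d)%N /\ exists b, T b /\ T (b + d)%N >].
have exD : exists d, D d.
  exists t1; apply/asboolP; split; first exact: Tpos.
  by exists t1; split => //; exact: Tadd.
have [d /asboolP[d0 [b [Tb Tbd]]] dmin] := ex_minnP exD.
have b0 := Tpos _ Tb.
suff d1 : d = 1%N.
  rewrite d1 addn1 in Tbd; exists (b * b)%N => t bt.
  rewrite (divn_eq t b); have := ltn_pmod t b0; set r := (t %% b)%N => rb.
  have bq : (b <= t %/ b)%N by rewrite leq_divRL.
  have -> : (t %/ b * b + r = (t %/ b - r).-1.+1 * b + r * b.+1)%N.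
    rewrite prednK ?subn_gt0 ?(leq_trans rb)// mulnBl mulnS.
    have : (r * b <= t %/ b * b)%N by rewrite leq_mul2r (ltnW (leq_trans rb bq)) orbT.
    lia.
  case: r rb => [|r] rb; first by rewrite mul0n addn0; exact: semigroup_mul.
  by apply: (Tadd _ _); [exact: (semigroup_mul _ Tadd Tb) | exact: (semigroup_mul _ Tadd Tbd)].
apply/eqP; rewrite -dvdn1; apply: Tgcd => n Tn; apply: contrapT => /negP dn.
have r0 : (0 < n %% d)%N by rewrite lt0n.
have rd : (n %% d < d)%N by rewrite ltn_mod.
have := dmin (n %% d)%N; rewrite leqNgt rd => /(_ _)/negP; apply => //.
apply/asboolP; split => //.
have [q0|q0] := posnP (n %/ d).
  exists n; split => //; have -> : (n %% d = n)%N by rewrite {2}(divn_eq n d) q0.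
  exact: (Tadd _ _).
exists ((n %/ d).-1.+1 * (b + d))%N; split; first exact: semigroup_mul.
have -> : ((n %/ d).-1.+1 * (b + d) + n %% d = (n %/ d).-1.+1 * b + n)%N.
  by rewrite prednK// mulnDr -addnA -divn_eq.
by apply: (Tadd _ _) => //; exact: (semigroup_mul _ Tadd Tb).
Qed.

End NumericalSemigroup.

Section Words.
Variables (q k : nat) (W : {set k.-tuple 'I_q}) (w : k.-tuple 'I_q).

Lemma windowP (x x' : int -> 'I_q) i i' : window k x i = window k x' i' <->
  forall j : nat, (j < k)%N -> x (i + j.+1%:Z) = x' (i' + j.+1%:Z).
Proof.
split=> [xx' j jk|xx'].
  by have := congr1 (fun u => tnth u (Ordinal jk)) xx'; rewrite !tnth_mktuple.
by apply: eq_from_tnth => j; rewrite !tnth_mktuple; exact: xx'.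
Qed.

(** Two configurations that both show [w] can be glued along it. *)
Lemma return_timesD s t : return_times W w s -> return_times W w t ->
  return_times W w (s + t)%N.
Proof.
move=> [s1 [x [Sx x0 xs]]] [t1 [x' [Sx' x'0 x't]]]; split; first by rewrite addn_gt0 s1.
have glue : forall j : nat, (j < k)%N -> x (s%:Z + j.+1%:Z) = x' j.+1%:Z.
  by move=> j jk; have /windowP := etrans xs (esym x'0); move=> /(_ j jk); rewrite add0r.
pose z (i : int) := if i <= s%:Z then x i else x' (i - s%:Z).
have zl (i : int) : i <= s%:Z -> window k z i = window k x i.
  move=> ils; apply/windowP => j jk; rewrite /z; case: ifP => // /negbT; rewrite -ltNge => sij.
  have [m [mk em]] : exists m : nat, (m < k)%N /\ i + j.+1%:Z = s%:Z + m.+1%:Z.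
    by exists (absz (i + j%:Z - s%:Z)%R); lia.
  by rewrite em glue//; congr x'; lia.
have zr (i : int) : s%:Z <= i -> window k z i = window k x' (i - s%:Z).
  move=> si; apply/windowP => j jk; rewrite /z; case: ifP => [|_]; first lia.
  by congr x'; lia.
exists z; split.
- move=> i; have [ils|/ltW si] := leP i s%:Z; first by rewrite zl//; exact: Sx.
  by rewrite zr//; exact: Sx'.
- by rewrite zl.
- rewrite zr; last lia.
  by rewrite (_ : (s + t)%:Z - s%:Z = t%:Z)//; lia.
Qed.

Lemma return_times_large : is_gcd (return_times W w) 1 ->
  exists n0, forall t, (n0 <= t)%N -> return_times W w t.
Proof.
by apply: semigroup_large => [t []//|s t]; exact: return_timesD.
Qed.

Variable t0 : nat.
Hypotheses (k0 : (0 < k)%N) (t0k : (k <= t0)%N).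
Variable p : nat -> int -> 'I_q.
Hypothesis pP : forall t, (t0 <= t)%N ->
  [/\ shift_ft W (p t), window k (p t) 0 = w & window k (p t) t%:Z = w].

(** Stated with a displacement [e]: two markers closer than [t0] coincide. *)
Definition separated (J : int -> bool) :=
  forall i e, J i -> J (i + e) -> `|e| < t0%:Z -> e = 0.

Definition covered (J : int -> bool) (i : int) :=
  exists2 e, `|e| < t0%:Z & J (i + e).

(** The letter at the origin: [s] is the distance to the last marker strictly to the left,
    [t] the distance to the first marker on the right, the origin included, and [p]
    gives the filling of a gap of length [s + t]. *)
Definition letter (J : int -> bool) : 'I_q :=
  let s := (find (fun j : nat => J (- j.+1%:Z)) (iota 0 t0.*2)).+1 in
  let t := find (fun j : nat => J j%:Z) (iota 0 t0.*2) in
  p (s + t) s%:Z.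

Lemma find_iota (a : pred nat) n j : (j < n)%N -> a j ->
  [/\ (find a (iota 0 n) <= j)%N, a (find a (iota 0 n)) &
      forall i, (i < find a (iota 0 n))%N -> ~~ a i].
Proof.
move=> jn aj.
have ha : has a (iota 0 n) by apply/hasP; exists j; rewrite // mem_iota.
have fn : (find a (iota 0 n) < n)%N by rewrite -[X in (_ < X)%N](size_iota 0) -has_find.
split.
- rewrite leqNgt; apply/negP => jf; have := before_find 0%N jf.
  by rewrite nth_iota// aj.
- by have := nth_find 0%N ha; rewrite nth_iota.
- by move=> i fi; have /negbT := before_find 0%N fi; rewrite nth_iota// (ltn_trans fi).
Qed.

(** If all sites around [m] are within [t0] of a marker, the search bounds in [letter]
    suffice, and separation together with covering puts the gap in [t0, 2 t0). *)
Lemma letterP J (m : int) : separated J ->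
  (forall i, `|i - m| <= t0.*2%:Z -> covered J i) ->
  exists a b, [/\ J a, J b, a < m <= b, a + t0%:Z <= b /\ b < a + t0.*2%:Z
    & (forall i, a < i < b -> ~~ J i) /\
      letter (fun i => J (m + i)) = p (absz (b - a)%R) (m - a)].
Proof.
move=> sJ cJ.
have [e1 e1t J1] : covered J (m - t0%:Z) by apply: cJ; lia.
have [e2 e2t J2] : covered J (m + t0%:Z - 1) by apply: cJ; lia.
have [||fs Js ns] := @find_iota (fun j : nat => J (m + - j.+1%:Z)) t0.*2 (absz (t0%:Z - e1 - 1)%R).
- lia.
- by rewrite (_ : m + _ = m - t0%:Z + e1)//; lia.
have [||ft Jt nt] := @find_iota (fun j : nat => J (m + j%:Z)) t0.*2 (absz (t0%:Z - 1 + e2)%R).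
- lia.
- by rewrite (_ : m + _ = m + t0%:Z - 1 + e2)//; lia.
rewrite /letter; move: fs Js ns ft Jt nt.
set s := find _ _; set t := find _ _ => fs Js ns ft Jt nt.
have nJ (i : int) : m + - s.+1%:Z < i < m + t%:Z -> ~~ J i.
  move=> ist; have [im|mi] := ltP i m.
    have ei : m + - (absz (m - i - 1)%R).+1%:Z = i by lia.
    by have /= := ns (absz (m - i - 1)%R); rewrite ei; apply; lia.
  have ei : m + (absz (i - m)%R)%:Z = i by lia.
  by have /= := nt (absz (i - m)%R); rewrite ei; apply; lia.
exists (m + - s.+1%:Z), (m + t%:Z); split=> //; first lia.
- split.
    rewrite leNgt; apply/negP => lt; have := sJ _ (s.+1%:Z + t%:Z) Js.
    by rewrite (_ : _ + (_ + _) = m + t%:Z) => [/(_ Jt)|]; lia.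
  rewrite ltNge; apply/negP => le.
  have [|e et Je] := cJ (m + - s.+1%:Z + t0%:Z); first lia.
  by have : ~~ J (m + - s.+1%:Z + t0%:Z + e); [apply: nJ; lia | rewrite Je].
- by split=> //; congr p; lia.
Qed.

(** A window that starts in the gap from [a] to [b] and does not end there shows, past [b],
    the initial part of the next filling, which is an initial part of [w] because
    [k <= t0].  The filling of the first gap continues with [w] too, so the whole window
    is one of its windows. *)
Lemma word_in_W J (i : int) : separated J ->
  (forall (j : nat) l, (j < k)%N -> `|l - (i + j.+1%:Z)| <= t0.*2%:Z -> covered J l) ->
  window k (fun m => letter (fun l => J (m + l))) i \in W.
Proof.
move=> sJ cJ.
have [|a [b [Ja Jb ab [ab1 ab2] [nJ _]]]] := @letterP J (i + 1) sJ.
  by move=> l; apply: (cJ 0%N).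
have tab : (t0 <= (absz (b - a)%R))%N by lia.
have [Sp p0 pt] := pP tab.
suff -> : window k (fun m => letter (fun l => J (m + l))) i =
    window k (p (absz (b - a)%R)) (i - a) by exact: Sp.
apply/windowP => j jk.
have [|a' [b' [Ja' Jb' ab' [ab1' ab2'] [nJ' ->]]]] := @letterP J (i + j.+1%:Z) sJ.
  by move=> l; apply: cJ.
have nn (x : int) : J x -> ~~ (a < x < b).
  by move=> Jx; apply/negP => /nJ; rewrite Jx.
have nn' (x : int) : J x -> ~~ (a' < x < b').
  by move=> Jx; apply/negP => /nJ'; rewrite Jx.
have := nn _ Ja'; have := nn _ Jb'; have := nn' _ Ja; have := nn' _ Jb.
move=> h1 h2 h3 h4.
have [ij|ij] := leP (i + j.+1%:Z) b.
  have -> : a' = a by lia.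
  have -> : b' = b by lia.
  by congr p; lia.
have ea' : a' = b.
  have := sJ b (a' - b) Jb; rewrite (_ : b + _ = a'); last lia.
  by move=> /(_ Ja'); lia.
have tab' : (t0 <= (absz (b' - a')%R))%N by lia.
have [_ p0' _] := pP tab'.
have /windowP/(_ (absz (i + j%:Z - b)%R)) := etrans p0' (esym pt).
rewrite add0r => h; rewrite (_ : i + j.+1%:Z - a' = (absz (i + j%:Z - b)%R).+1%:Z); last lia.
by rewrite h; [congr p; lia | lia].
Qed.

End Words.

(** * Colour reduction *)

Section ColourReduction.

Definition nat_bit (a j : nat) : bool := odd (a %/ 2 ^ j).

Lemma nat_bit_ext m a b : (a < 2 ^ m)%N -> (b < 2 ^ m)%N ->
  (forall j, (j < m)%N -> nat_bit a j = nat_bit b j) -> a = b.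
Proof.
elim: m a b => [|m IH] a b; first by rewrite !expn0; case: a => //; case: b.
move=> am bm ab; have ab0 := ab 0%N isT; rewrite /nat_bit expn0 !divn1 in ab0.
rewrite -(odd_double_half a) -(odd_double_half b) ab0; congr (_ + _.*2)%N.
apply: IH => [||j jm].
- by rewrite ltn_half_double -mul2n -expnS.
- by rewrite ltn_half_double -mul2n -expnS.
- by have := ab j.+1 jm; rewrite /nat_bit expnS -!divn2 -!divnMA.
Qed.

(** The Cole-Vishkin step: the place of the first binary digit where [a] and [b] differ,
    paired with the digit of [a] there.  The value for [a = b] only has to be small. *)
Definition first_diff (m a b : nat) : nat :=
  if a == b then 0%N
  else let j := find (fun j => nat_bit a j != nat_bit b j) (iota 0 m) in
       (nat_bit a j + j.*2)%N.

Lemma first_diffP m a b : (a < 2 ^ m)%N -> (b < 2 ^ m)%N -> a != b ->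
  exists j, [/\ (j < m)%N, nat_bit a j != nat_bit b j & first_diff m a b = (nat_bit a j + j.*2)%N].
Proof.
move=> am bm ab; rewrite /first_diff (negPf ab).
set D : pred nat := fun j => nat_bit a j != nat_bit b j; have hD : has D (iota 0 m).
  apply: contraT => nD; case/negP: ab; apply/eqP/(nat_bit_ext am bm) => j jm.
  apply/eqP; apply: contraNT nD => Dj; apply/hasP; exists j => //.
  by rewrite mem_iota.
have fm : (find D (iota 0 m) < m)%N by rewrite -[X in (_ < X)%N](size_iota 0) -has_find.
exists (find D (iota 0 m)); split=> //.
by have := nth_find 0%N hD; rewrite nth_iota.
Qed.

Lemma first_diff_lt m a b : (0 < m)%N -> (a < 2 ^ m)%N -> (b < 2 ^ m)%N -> (first_diff m a b < m.*2)%N.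
Proof.
move=> m0 am bm; have [ab|ab] := eqVneq a b; first by rewrite /first_diff ab eqxx double_gt0.
by have [j [jm _ ->]] := first_diffP am bm ab; case: (nat_bit a j); lia.
Qed.

(** Equal outputs would name the same place [j] and the same digit, so [a] and [b] would
    have the same digit at [j], a place where they differ. *)
Lemma first_diff_proper m a b c : (a < 2 ^ m)%N -> (b < 2 ^ m)%N -> (c < 2 ^ m)%N ->
  a != b -> b != c -> first_diff m a b != first_diff m b c.
Proof.
move=> am bm cm ab bc.
have [j [_ dj ->]] := first_diffP am bm ab; have [l [_ _ ->]] := first_diffP bm cm bc.
apply/eqP => e; have ejl : j = l by move: e; case: (nat_bit a j); case: (nat_bit b l); lia.
by move: e dj; rewrite -ejl => /addIn; case: (nat_bit a j); case: (nat_bit b j).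
Qed.

(** Number of bits of a label that [S] Cole-Vishkin rounds reduce to 4 bits: a round turns
    colours of [m] bits into colours below [2 * m], and [label_size] is chosen so that
    this is exactly [2 ^ label_size S] for [m = label_size S.+1]. *)
Fixpoint label_size (S : nat) : nat := if S is S'.+1 then (2 ^ (label_size S').-1)%N else 4.

Lemma label_size_gt0 S : (0 < label_size S)%N.
Proof. by case: S => //= S; rewrite expn_gt0. Qed.

Lemma double_label_sizeS S : (label_size S.+1).*2 = (2 ^ label_size S)%N.
Proof. by rewrite -mul2n /= -expnS prednK ?label_size_gt0. Qed.

(** Colour reduction along the progression [i, i + d, i + 2 d, ...]. *)
Fixpoint cole_vishkin (d : int) (S : nat) (c : int -> nat) : int -> nat :=
  if S is S'.+1 then cole_vishkin d S' (fun i => first_diff (label_size S) (c i) (c (i + d))) else c.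

Lemma cole_vishkin_lt d S c i : (forall i, c i < 2 ^ label_size S)%N -> (cole_vishkin d S c i < 16)%N.
Proof.
elim: S c => [|S IH] c cS /=; first exact: cS.
by apply: IH => l; rewrite -double_label_sizeS; apply: first_diff_lt => //; exact: (label_size_gt0 S.+1).
Qed.

Lemma cole_vishkin_proper d S c i : (forall i, c i < 2 ^ label_size S)%N ->
  (forall j : nat, (j <= S)%N -> c (i + d *+ j) != c (i + d *+ j.+1)) ->
  cole_vishkin d S c i != cole_vishkin d S c (i + d).
Proof.
elim: S c => [|S IH] c cS cd /=; first by have := cd 0%N; rewrite mulr0n mulr1n addr0; apply.
apply: IH => [l|j jS]; first by rewrite -double_label_sizeS;
  apply: first_diff_lt => //; exact: (label_size_gt0 S.+1).
have := cd j (leqW jS); have := cd j.+1 jS; rewrite !mulrSr !addrA.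
by move=> h1 h2; apply: first_diff_proper.
Qed.

Lemma cole_vishkin_local d S c c' i :
  (forall j : nat, (j <= S)%N -> c (i + d *+ j) = c' (i + d *+ j)) ->
  cole_vishkin d S c i = cole_vishkin d S c' i.
Proof.
elim: S c c' => [|S IH] c c' cc' /=; first by have := cc' 0%N; rewrite mulr0n addr0; apply.
apply: IH => j jS; rewrite -addrA -mulrSr.
by rewrite cc' ?cc'//; exact: leqW.
Qed.

Lemma cole_vishkin_shift d S c n i :
  cole_vishkin d S (fun l => c (l + n)) i = cole_vishkin d S c (i + n).
Proof.
elim: S c => //= S IH c; rewrite -IH; congr (cole_vishkin d S _ i); apply/funext => l.
by rewrite addrAC.
Qed.

Fixpoint label (n : nat) (b : nat -> bool) : nat :=
  if n is n'.+1 then ((b n') * 2 ^ n' + label n' b)%N else 0%N.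

Lemma label_lt n b : (label n b < 2 ^ n)%N.
Proof.
by elim: n => //= n IH; rewrite expnS mul2n -addnn; case: (b n); rewrite ?mul1n ?mul0n; lia.
Qed.

Lemma eq_label n b b' : (forall l, (l < n)%N -> b l = b' l) -> label n b = label n b'.
Proof.
elim: n => //= n IH bb'; rewrite bb'// IH// => l ln.
by rewrite bb'// (ltn_trans ln).
Qed.

Lemma label_inj n b b' : label n b = label n b' ->
  forall l, (l < n)%N -> b l = b' l.
Proof.
elim: n => //= n IH; have := label_lt n b; have := label_lt n b'.
move=> h h' e l; have [eb el] : b n = b' n /\ label n b = label n b'.
  by move: e; case: (b n); case: (b' n); rewrite ?mul1n ?mul0n; lia.
by rewrite ltnS leq_eqVlt => /orP[/eqP->//|]; exact: IH.
Qed.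

End ColourReduction.

(** * Greedy selection of markers *)

Section Greedy.
Variable t0 : nat.
Hypothesis t00 : (0 < t0)%N.

Definition offsets : seq int := [seq j%:Z - t0%:Z | j <- iota 1 (t0.*2.-1)].

Lemma mem_offsets e : (e \in offsets) = (`|e| < t0%:Z).
Proof.
apply/mapP/idP => [[j]|et]; first by rewrite mem_iota => ? ->; lia.
by exists (absz (e + t0%:Z)%R); [rewrite mem_iota | ]; lia.
Qed.

Definition blocked (J : int -> bool) (i : int) := has (fun e => J (i + e)) offsets.

Lemma blockedP J i : reflect (covered t0 J i) (blocked J i).
Proof.
apply: (iffP hasP) => [[e]|[e et Je]]; last by exists e; rewrite // mem_offsets.
by rewrite mem_offsets => et Je; exists e.
Qed.

Variable T : finType.
Implicit Types (phi : int -> T) (J : int -> bool).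

(** Comparing with the actual colours of the neighbours keeps the markers separated even
    where the colouring is not proper. *)
Definition isolated phi (c : T) (i : int) :=
  (phi i == c) && all (fun e => (e != 0) ==> (phi (i + e) != c)) offsets.

Definition step phi J (c : T) : int -> bool :=
  fun i => J i || isolated phi c i && ~~ blocked J i.

Definition sweep phi J : int -> bool := foldl (step phi) J (enum T).

Lemma step_sub phi J c i : J i -> step phi J c i.
Proof. by rewrite /step => ->. Qed.

Lemma steps_sub phi J s i : J i -> foldl (step phi) J s i.
Proof. by elim: s J => //= c s IH J Ji; apply: IH; exact: step_sub. Qed.

(** A new marker is not blocked, and two sites added in the same step have the same
    colour, which isolation forbids. *)
Lemma step_separated phi J c : separated t0 J -> separated t0 (step phi J c).
Proof.
move=> sJ i e /orP[Ji|/andP[/andP[pi iso] nJ]] /orP[Je|/andP[/andP[pe isoe] nJe]] et.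
- exact: sJ Ji Je et.
- case/blockedP: nJe; exists (- e); first by rewrite normrN.
  by rewrite addrK.
- by case/blockedP: nJ; exists e.
- apply/eqP; apply: contraT => e0; move/allP: iso => /(_ e); rewrite mem_offsets et e0 pe.
  by move=> /(_ isT).
Qed.

Lemma steps_separated phi J s : separated t0 J -> separated t0 (foldl (step phi) J s).
Proof. by elim: s J => //= c s IH J sJ; apply: IH; exact: step_separated. Qed.

(** When the colour class of [i] is swept, [i] is either blocked already or becomes a
    marker.  A marker blocks its own site, as [0] is among the offsets. *)
Lemma sweep_blocked phi J i : isolated phi (phi i) i -> blocked (sweep phi J) i.
Proof.
move=> iso; rewrite /sweep.
have : phi i \in enum T by rewrite mem_enum.
elim: (enum T) J => //= c s IH J; rewrite inE => /orP[/eqP ec|]; last exact: IH.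
have /blockedP[e et Je] : blocked (step phi J c) i.
  apply/blockedP; have [/blockedP[e et Je]|nJ] := boolP (blocked J i).
    by exists e => //; exact: step_sub.
  by exists 0; rewrite ?normr0 ?ltz_nat// addr0 /step -ec iso nJ orbT.
by apply/blockedP; exists e => //; exact: steps_sub.
Qed.

Lemma step_shift phi J c (n i : int) :
  step (fun l => phi (l + n)) (fun l => J (l + n)) c i = step phi J c (i + n).
Proof.
rewrite /step /isolated /blocked; congr (_ || (_ && _ && ~~ _)).
  by apply: eq_all => e; rewrite addrAC.
by apply: eq_has => e; rewrite addrAC.
Qed.

Lemma steps_shift phi J s (n i : int) :
  foldl (step (fun l => phi (l + n))) (fun l => J (l + n)) s i =
  foldl (step phi) J s (i + n).
Proof.
elim: s J => //= c s IH J; rewrite -IH; congr (foldl _ _ s i).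
by apply/funext => l; exact: step_shift.
Qed.

(** Each step of the sweep looks at most [t0] further. *)
Lemma steps_local phi phi' J J' s (rho : nat) (i : int) :
  (forall l : int, `|l - i| <= (rho + size s * t0)%N%:Z -> phi l = phi' l) ->
  (forall l : int, `|l - i| <= (rho + size s * t0)%N%:Z -> J l = J' l) ->
  forall l : int, `|l - i| <= rho%:Z -> foldl (step phi) J s l = foldl (step phi') J' s l.
Proof.
elim: s J J' => [|c s IH] J J' /= hp hJ l li; first by apply: hJ; lia.
apply: IH => // m mi; first by apply: hp; lia.
rewrite /step /isolated /blocked hJ; last lia.
have -> : phi m = phi' m by apply: hp; lia.
congr (_ || (_ && _ && ~~ _)).
  by apply: eq_in_all => e; rewrite mem_offsets => et; rewrite hp//; lia.
by apply: eq_in_has => e; rewrite mem_offsets => et; rewrite hJ//; lia.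
Qed.

End Greedy.

Section Stages.
Variables (t0 m0 : nat).
Hypothesis t00 : (0 < t0)%N.

Local Notation bits := (nat -> bool).
Local Notation T := {ffun 'I_t0 -> 'I_16}.
Implicit Types (y : int -> bits).

(** One Cole-Vishkin colouring for every distance [d < t0]: two sites at distance [d] are
    told apart by the component of index [d].  The component of index 0 is constant. *)
Definition colour (S : nat) y (i : int) : T :=
  [ffun d : 'I_t0 => inord (cole_vishkin d%:Z S (fun l => label (label_size S) (y l)) i)].

(** Stage [s] uses [s + m0] rounds: the head start [m0] makes the failure probability small
    enough to absorb the polynomial factors of the union bound. *)
Fixpoint markers (s : nat) y : int -> bool :=
  if s is s'.+1 then sweep t0 (colour (s' + m0) y) (markers s' y) else fun=> false.

Definition radius_bound (s : nat) := (t0 * (#|T|.+1 * s + m0 + 3))%N.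

Lemma colour_shift S y (n i : int) : colour S (translate n y) i = colour S y (i + n).
Proof.
apply/ffunP => d; rewrite !ffunE; congr inord.
by rewrite -(cole_vishkin_shift _ _ (fun l => label (label_size S) (y l))).
Qed.

Lemma markers_shift s y (n i : int) : markers s (translate n y) i = markers s y (i + n).
Proof.
elim: s i => //= s IH i; rewrite /sweep -steps_shift; congr (foldl (step t0 _) _ _ i).
  by apply/funext => l; exact: colour_shift.
by apply/funext => l; exact: IH.
Qed.

Lemma markers_separated s y : separated t0 (markers s y).
Proof. by elim: s => //= s IH; exact: (steps_separated t00). Qed.

Lemma markers_sub s s' y i : (s <= s')%N -> markers s y i -> markers s' y i.
Proof.
move=> /subnK <-; elim: (s' - s)%N => //= n IH /IH; exact: steps_sub.
Qed.

Lemma colour_local S y y' (i : int) :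
  (forall l : int, `|l - i| <= (S * t0)%N%:Z -> forall b, (b < label_size S)%N -> y l b = y' l b) ->
  colour S y i = colour S y' i.
Proof.
move=> yy'; apply/ffunP => d; rewrite !ffunE; congr inord.
apply: cole_vishkin_local => j jS; apply: eq_label => b bS; apply: yy' => //.
have := ltn_ord d => dt; rewrite -mulr_natr natz; nia.
Qed.

Lemma markers_local s N y y' i : (forall r, (r < s)%N -> (label_size (r + m0) <= N)%N) ->
  (forall l : int, `|l - i| <= (radius_bound s)%:Z -> forall b, (b < N)%N -> y l b = y' l b) ->
  markers s y i = markers s y' i.
Proof.
elim: s i => //= s IH i hN yy'; rewrite /sweep.
apply: (steps_local t00 (rho := 0) (i := i)); last by rewrite subrr.
- move=> l; rewrite -cardE add0n => li; apply: colour_local => m ml b bS.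
  apply: yy'; last by rewrite (leq_trans bS)//; exact: hN.
  rewrite /radius_bound; move: li ml; set M := #|T|; nia.
- move=> l; rewrite -cardE add0n => li; apply: IH => [r rs|m ml b bN].
    by apply: hN; rewrite ltnS ltnW.
  apply: yy' => //; move: li ml; rewrite /radius_bound; set M := #|T|; nia.
Qed.

(** The site [i] is compared with both [i + d] and [i - d], so the labels of the progression
    are needed from [i - d] on; that is the reason for the shift by [d]. *)
Lemma markers_blocked s y (i : int) :
  let S := (s + m0)%N in
  (forall d j : nat, (0 < d < t0)%N -> (j <= S.+1)%N ->
    label (label_size S) (y (i - d%:Z + d%:Z *+ j)) !=
    label (label_size S) (y (i - d%:Z + d%:Z *+ j.+1))) ->
  blocked t0 (markers s.+1 y) i.
Proof.
move=> S dist; apply: sweep_blocked => //.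
rewrite /isolated eqxx /=; apply/allP => e; rewrite (mem_offsets t00) => et; apply/implyP => e0.
have dt : (absz e < t0)%N by lia.
have cS l : (label (label_size S) (y l) < 2 ^ label_size S)%N by exact: label_lt.
(* Both ends i and i - d of the comparisons keep a colour distinct from the next. *)
have main (a : int) : (a = i \/ a = i - (absz e)%:Z) ->
    cole_vishkin (absz e)%:Z S (fun l => label (label_size S) (y l)) a !=
      cole_vishkin (absz e)%:Z S (fun l => label (label_size S) (y l)) (a + (absz e)%:Z).
  move=> ha; apply: cole_vishkin_proper => // j jS.
  case: ha => ->; last by apply: dist; lia.
  have em m : i - (absz e)%:Z + (absz e)%:Z *+ m.+1 = i + (absz e)%:Z *+ m.
    by rewrite mulrS addrA subrK.
  by have := dist (absz e) j.+1; rewrite !em; apply; lia.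
have lt16 (a : int) :
    (cole_vishkin (absz e)%:Z S (fun l => label (label_size S) (y l)) a < 16)%N.
  exact: cole_vishkin_lt.
apply/eqP => /ffunP/(_ (Ordinal dt)); rewrite !ffunE /= => /(congr1 val).
rewrite /= !inordK// => ecv.
have [pe|ne] := leP 0 e.
  have /eqP[] := main i (or_introl erefl).
  by rewrite -ecv; congr cole_vishkin; lia.
have /eqP[] := main _ (or_intror erefl).
rewrite subrK -ecv; congr cole_vishkin; lia.
Qed.

Variables (q k : nat) (p : nat -> int -> 'I_q).

Definition window_sites : seq int := [seq j%:Z - t0.*2%:Z | j <- iota 0 (4 * t0).+1].

Lemma mem_window_sites (i : int) : (i \in window_sites) = (`|i| <= t0.*2%:Z).
Proof.
apply/mapP/idP => [[j]|it]; first by rewrite mem_iota => ? ->; lia.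
by exists (absz (i + t0.*2%:Z)%R); [rewrite mem_iota | ]; lia.
Qed.

(** A number of stages whose outcome around the origin is decided by the sites up to
    distance [n], by [stage_radius]. *)
Definition stage (n : nat) := ((n %/ t0 - (m0 + 7)) %/ #|T|.+1)%N.

Lemma stage_radius n : (0 < stage n)%N -> (radius_bound (stage n) + 4 * t0 <= n)%N.
Proof.
rewrite /stage /radius_bound; set M := #|T|; set s := (_ %/ M.+1)%N => s0.
have h1 : (s * M.+1 <= n %/ t0 - (m0 + 7))%N by exact: leq_trunc_div.
have h2 : (n %/ t0 * t0 <= n)%N by exact: leq_trunc_div.
nia.
Qed.

Lemma leq_stage n n' : (n <= n')%N -> (stage n <= stage n')%N.
Proof. by move=> nn'; apply: leq_div2r; apply: leq_sub2r; exact: leq_div2r. Qed.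

Definition complete (s : nat) y := all (blocked t0 (markers s y)) window_sites.

Lemma completeP s y :
  reflect (forall i : int, `|i| <= t0.*2%:Z -> covered t0 (markers s y) i) (complete s y).
Proof.
apply: (iffP allP) => [h i it|h i]; first by apply/(blockedP t00)/h; rewrite mem_window_sites.
by rewrite mem_window_sites => it; apply/(blockedP t00)/h.
Qed.

Definition rule (n : nat) y : option 'I_q :=
  if complete (stage n) y then Some (letter t0 p (markers (stage n) y)) else None.

Lemma letter_local (J J' : int -> bool) : (forall i : int, `|i| <= t0.*2%:Z -> J i = J' i) ->
  letter t0 p J = letter t0 p J'.
Proof.
move=> JJ'; rewrite /letter.
have -> : find (fun j : nat => J (- j.+1%:Z)) (iota 0 t0.*2) =
          find (fun j : nat => J' (- j.+1%:Z)) (iota 0 t0.*2).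
  by apply: eq_in_find => j; rewrite mem_iota => jt; apply: JJ'; lia.
have -> : find (fun j : nat => J j%:Z) (iota 0 t0.*2) =
          find (fun j : nat => J' j%:Z) (iota 0 t0.*2).
  by apply: eq_in_find => j; rewrite mem_iota => jt; apply: JJ'; lia.
by [].
Qed.

Lemma rule_local_bits n : exists N, forall y y',
  (forall i : int, `|i| <= n%:Z -> forall b, (b < N)%N -> y i b = y' i b) -> rule n y = rule n y'.
Proof.
pose N := (\max_(r < stage n) label_size (r + m0))%N; exists N => y y' yy'.
have JJ' (i : int) : `|i| <= 3%:Z * t0%:Z -> markers (stage n) y i = markers (stage n) y' i.
  have [s0|s0] := posnP (stage n); first by rewrite s0.
  have := stage_radius s0 => sr it; apply: (@markers_local _ N) => [r rs|l li b bN].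
    by rewrite /N (bigD1 (Ordinal rs)) //= leq_max leqnn.
  by apply: yy' => //; lia.
rewrite /rule (letter_local (J' := markers (stage n) y')) => [|i it]; last by apply: JJ'; lia.
congr (if _ then _ else _); apply: eq_in_all => i; rewrite mem_window_sites => it.
by apply: eq_in_has => e; rewrite (mem_offsets t00) => et; apply: JJ'; lia.
Qed.

(** A later marker near the origin is within [t0] of an early one, hence equal to it by
    separation. *)
Lemma complete_markers s s' y (i : int) : (s <= s')%N -> complete s y -> `|i| <= t0.*2%:Z ->
  markers s' y i = markers s y i.
Proof.
move=> ss' /completeP cs it; apply/idP/idP; last exact: markers_sub.
move=> Ji; have [e et Je] := cs _ it.
suff -> : i = i + e by [].
have := markers_separated (s := s') Ji (markers_sub ss' Je) et; lia.
Qed.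

(** Later stages do not change a complete neighbourhood. *)
Lemma rule_mono n n' y v : (n <= n')%N -> rule n y = Some v -> rule n' y = Some v.
Proof.
move=> /leq_stage ss'; rewrite /rule; case: ifP => // cs [<-].
have -> : complete (stage n') y.
  apply/completeP => i /(elimT (completeP _ _) cs)[e et Je].
  by exists e => //; exact: markers_sub Je.
by congr Some; apply: letter_local => i; exact: complete_markers.
Qed.

Variables (W : {set k.-tuple 'I_q}) (w : k.-tuple 'I_q).
Hypotheses (k0 : (0 < k)%N) (t0k : (k <= t0)%N).
Hypothesis pP : forall t, (t0 <= t)%N ->
  [/\ shift_ft W (p t), window k (p t) 0 = w & window k (p t) t%:Z = w].

Lemma rule_sound n y (x : int -> 'I_q) (i : int) :
  (forall j : nat, (j < k)%N ->
    rule n (translate (i + j.+1%:Z) y) = Some (x (i + j.+1%:Z))) ->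
  window k x i \in W.
Proof.
move=> xP; pose J := markers (stage n) y.
have JE m : (fun l => J (m + l)) = markers (stage n) (translate m y).
  by apply/funext => l; rewrite markers_shift addrC.
suff -> : window k x i = window k (fun m => letter t0 p (fun l => J (m + l))) i.
  apply: (word_in_W k0 t0k pP); first exact: markers_separated.
  move=> j l jk li; have := xP j jk; rewrite /rule; case: ifP => // /completeP cs _.
  have [e et Je] := cs _ li; exists e => //; move: Je; rewrite markers_shift.
  by rewrite (_ : _ + (i + _) = l + e)//; lia.
apply/windowP => j jk; have := xP j jk; rewrite /rule JE; case: ifP => // _.
by move=> [].
Qed.

End Stages.

(** * Independent random bit sequences *)

Section RandomBits.
Variable R : realType.

Definition bit_cyl (n : nat) (v : nat -> bool) : set (nat -> bool) :=
  [set b | forall j, (j < n)%N -> b j = v j].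

(** The empty set is added so that the family is closed under intersection. *)
Definition bit_cyls : set (set (nat -> bool)) :=
  [set E | E = set0 \/ exists n v, E = bit_cyl n v].

Definition bitseqs := g_sigma_algebraType bit_cyls.
HB.instance Definition _ := Measurable.on bitseqs.

Lemma bit_cylsI : setI_closed bit_cyls.
Proof.
move=> E E' [->|[n [v ->]]]; first by rewrite set0I; left.
move=> [->|[n' [v' ->]]]; first by rewrite setI0; left.
wlog nn' : n n' v v' / (n <= n')%N.
  by move=> H; have [h|/ltnW h] := leqP n n'; [exact: H | rewrite setIC; exact: H].
have [vv'|nvv'] := pselect (bit_cyl n v v'); last first.
  left; apply/seteqP; split=> // b [bv bv']; apply: nvv' => j jn.
  by rewrite -bv'// ?bv// (leq_trans jn).
right; exists n', v'; apply/seteqP; split=> [b []//|b bv']; split=> // j jn.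
by rewrite bv' ?vv'// (leq_trans jn).
Qed.

Lemma measurable_bit_cyl n v : measurable (bit_cyl n v : set bitseqs).
Proof. by apply: sub_sigma_algebra; right; exists n, v. Qed.

Definition bit (l : nat) (x : R) : bool := odd (Num.truncn (x * 2 ^+ l.+1)).

Lemma measurable_truncn_eq (c : R) m : 0 < c ->
  measurable [set x : R | Num.truncn (x * c) = m].
Proof.
move=> c0; have mlt n : measurable [set x : R | x * c < n%:R].
  rewrite (_ : [set x | _] = `]-oo, (n%:R / c)[%classic) ?measurable_itv//.
  by apply/seteqP; split=> x /=; rewrite in_itv /= ltr_pdivlMr.
have mle n : measurable [set x : R | (Num.truncn (x * c) <= n)%N].
  rewrite (_ : [set x | _] = [set x : R | x * c < n.+1%:R])//.
  by apply/seteqP; split=> x /=; rewrite truncn_le_nat.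
case: m => [|m].
  rewrite (_ : [set x | _] = [set x : R | (Num.truncn (x * c) <= 0)%N])//.
  by apply/seteqP; split=> x /=; rewrite leqn0 => /eqP.
rewrite (_ : [set x | _] = [set x : R | (Num.truncn (x * c) <= m.+1)%N] `\`
                           [set x : R | (Num.truncn (x * c) <= m)%N]).
  exact: measurableD.
by apply/seteqP; split=> x /=; [move=> ->; split=> //; lia | lia].
Qed.

Lemma measurable_bit l c : measurable [set x : R | bit l x = c].
Proof.
rewrite (_ : [set x | _] = \bigcup_(m in [set m | odd m = c])
    [set x : R | Num.truncn (x * 2 ^+ l.+1) = m]).
  by apply: bigcup_measurable => m _; apply: measurable_truncn_eq; rewrite exprn_gt0.
by apply/seteqP; split=> x /= [m]; [exists (Num.truncn (x * 2 ^+ l.+1)) | move=> /= <- <-].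
Qed.

Let P : probability (measurableTypeR R) R := uniform_prob (@ltr01 R).

(** The half-open interval is the one that dyadic intervals partition. *)
Lemma uniform01E (U : set R) : measurable U ->
  P U = lebesgue_measure (U `&` `[0, 1[%classic).
Proof.
move=> mU; have mU1 : measurable (U `&` `[0, 1]%classic) by exact: measurableI.
have mU2 : measurable (U `&` `[0, 1[%classic) by exact: measurableI.
transitivity (lebesgue_measure (U `&` `[0, 1]%classic)).
  rewrite /P /= /uniform_prob integral_uniform_pdf (eq_integral (fun=> 1%E)).
    by rewrite integral_cst// mul1e.
  by move=> x; rewrite inE /= in_itv /= => -[_ x01]; rewrite /uniform_pdf x01 subr0 invr1.
apply/eqP; rewrite eq_le; apply/andP; split; last first.
  apply: le_measure; rewrite ?inE//; apply: setIS => x /=; rewrite !in_itv /= => /andP[-> /ltW].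
  by [].
apply: (@le_trans _ _ (lebesgue_measure ((U `&` `[0, 1[%classic) `|` [set 1 : R]))).
  apply: le_measure; rewrite ?inE//; first exact: measurableU.
  move=> x [Ux]; rewrite /= !in_itv /= => /andP[x0]; rewrite le_eqVlt => /orP[/eqP->|x1].
    by right.
  by left; rewrite x0 x1.
apply: le_trans (measureU2 _ _ _) _ => //.
by rewrite [X in (_ + X)%E]lebesgue_measure_set1 adde0.
Qed.

Fixpoint bnum (v : nat -> bool) (n : nat) : nat :=
  if n is n'.+1 then (v n' + (bnum v n').*2)%N else 0%N.

Lemma bnum_lt v n : (bnum v n < 2 ^ n)%N.
Proof. by elim: n => //= n IH; rewrite expnS; case: (v n); lia. Qed.

Lemma truncn_double (x : R) : 0 <= x -> (Num.truncn (2 * x))./2 = Num.truncn x.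
Proof.
move=> x0; apply/esym/truncn_def.
have /andP[h1 h2] := truncn_itv (mulr_ge0 (ler0n R 2) x0).
set m := Num.truncn (2 * x) in h1 h2 *.
have e : (m = odd m + m./2.*2)%N by rewrite odd_double_half.
have e1 : (m%:R : R) = (odd m)%:R + 2 * (m./2)%:R.
  by rewrite {1}e natrD -muln2 natrM mulrC.
rewrite -(natr1 m) e1 in h2; rewrite e1 in h1; rewrite -(natr1 m./2).
by case: (odd m) h1 h2 => /= h1 h2; apply/andP; split; lra.
Qed.

(** The first [n] binary digits of [x] are those of the integer part of [x * 2 ^ n]. *)
Lemma bits_truncn (x : R) v n : 0 <= x < 1 ->
  (forall l, (l < n)%N -> bit l x = v l) <-> Num.truncn (x * 2 ^+ n) = bnum v n.
Proof.
move=> /andP[x0 x1]; elim: n => [|n IH] /=.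
  by rewrite expr0 mulr1; split=> // _; apply: truncn_def; rewrite x0.
have e : (Num.truncn (x * 2 ^+ n.+1))./2 = Num.truncn (x * 2 ^+ n).
  rewrite -[RHS]truncn_double ?mulr_ge0// ?exprn_ge0//.
  by rewrite exprS mulrCA.
split=> [bv|tv].
  rewrite -(odd_double_half (Num.truncn _)) e -[odd _]/(bit n x) bv//.
  by have /IH -> : forall l, (l < n)%N -> bit l x = v l by move=> l ln; apply: bv; exact: leqW.
have on : bit n x = v n by rewrite /bit tv oddD odd_double addbF oddb.
have : Num.truncn (x * 2 ^+ n) = bnum v n.
  by rewrite -e tv halfD odd_double andbF add0n doubleK; case: (v n).
by move=> /IH bv l; rewrite ltnS leq_eqVlt => /orP[/eqP->//|]; exact: bv.
Qed.

Lemma measurable_bits (s : seq nat) v :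
  measurable [set x : R | forall l, l \in s -> bit l x = v l].
Proof.
elim: s => [|a s IH].
  by rewrite (_ : [set x | _] = setT)//; apply/seteqP; split.
rewrite (_ : [set x | _] = [set x : R | bit a x = v a] `&`
   [set x : R | forall l, l \in s -> bit l x = v l]).
  by apply: measurableI => //; exact: measurable_bit.
apply/seteqP; split=> [x h|x [ha h] l].
  by split=> [|l ls]; apply: h; rewrite inE ?eqxx ?ls ?orbT.
by rewrite inE => /orP[/eqP->//|]; exact: h.
Qed.

Lemma prob_first_bits n v :
  P [set x | forall l, l \in iota 0 n -> bit l x = v l] = ((2 ^+ n)^-1)%:E.
Proof.
rewrite uniform01E; last exact: measurable_bits.
have p0 : (0 : R) < 2 ^+ n by rewrite exprn_gt0.
have := bnum_lt v n; set m := bnum v n => mn.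
have mn1 : (m.+1%:R : R) <= 2 ^+ n by rewrite -natrX ler_nat.
rewrite (_ : _ `&` _ = `[m%:R / 2 ^+ n, m.+1%:R / 2 ^+ n[%classic).
  rewrite lebesgue_measure_itv /= lte_fin ltr_pM2r ?invr_gt0// ltr_nat ltnSn.
  by rewrite -EFinB -mulrBl -natrB// subSnn mul1r.
apply/seteqP; split=> x /=.
  move=> [h]; rewrite !in_itv /= => x01.
  have : Num.truncn (x * 2 ^+ n) = m.
    by apply/(bits_truncn _ _ x01) => l ln; apply: h; rewrite mem_iota.
  have /andP[x0 _] := x01; have := truncn_itv (mulr_ge0 x0 (ltW p0)) => + e.
  by rewrite e ler_pdivrMr// ltr_pdivlMr.
rewrite in_itv /= => /andP[]; rewrite ler_pdivrMr// ltr_pdivlMr// => h1 h2.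
have x01 : 0 <= x < 1.
  apply/andP; split; first by rewrite -(pmulr_lge0 _ p0) (le_trans _ h1).
  by rewrite -(ltr_pM2r p0) mul1r (lt_le_trans h2).
split; last by rewrite in_itv.
move=> l; rewrite mem_iota /= add0n; move: l; apply/(bits_truncn _ _ x01).
by apply: truncn_def; rewrite h1.
Qed.

(** By induction on the number of indices missing from [s]: a missing bit splits the
    event into two events of equal probability. *)
Lemma prob_bits (s : seq nat) v : uniq s ->
  P [set x | forall l, l \in s -> bit l x = v l] = ((2 ^+ size s)^-1)%:E.
Proof.
have [n sn] : exists n, {subset s <= iota 0 n}.
  exists (\max_(l <- s) l).+1 => l ls.
  by rewrite mem_iota ltnS (big_rem l)//= leq_max leqnn.
have [m mE] : exists m, m = (n - size s)%N by eexists.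
move=> us; elim: m s v mE sn us => [|m IH] s v mE sn us.
  have ss : (size s <= n)%N by rewrite -(size_iota 0 n) uniq_leq_size.
  have en : size s = n by lia.
  have [_ eqs] := uniq_min_size us sn (eq_leq (etrans (size_iota 0 n) (esym en))).
  rewrite -(prob_first_bits _ v) en; congr (P _); apply/seteqP; split=> x h l ls; apply: h.
    by rewrite eqs.
  by rewrite -eqs.
have [a an as_] : exists2 a, a \in iota 0 n & a \notin s.
  apply: contrapT => h; have : (n <= size s)%N; last lia.
  rewrite -{1}(size_iota 0 n); apply: uniq_leq_size; first exact: iota_uniq.
  by move=> a an; apply: contrapT => /negP nas; apply: h; exists a.
pose v' c := fun l => if l == a then c else v l.
have IHc c : P [set x | forall l, l \in a :: s -> bit l x = v' c l] = ((2 ^+ (size s).+1)^-1)%:E.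
  rewrite IH//=; first lia.
    by move=> l; rewrite inE => /orP[/eqP->//|/sn].
  by rewrite as_.
rewrite (_ : [set x | _] = [set x | forall l, l \in a :: s -> bit l x = v' true l] `|`
  [set x | forall l, l \in a :: s -> bit l x = v' false l]).
  rewrite measureU; [|exact: measurable_bits|exact: measurable_bits|].
    transitivity (((2 ^+ (size s).+1)^-1)%:E + ((2 ^+ (size s).+1)^-1)%:E : \bar R)%E.
      by congr (_ + _)%E; exact: IHc.
    by rewrite -EFinD exprS; congr EFin; field; rewrite expf_neq0.
  apply/seteqP; split=> // x [/(_ a) + /(_ a)].
  by rewrite mem_head /v' eqxx => -> // /(_ isT).
have va l c : l \in s -> v' c l = v l.
  by rewrite /v'; case: eqP => // ->; rewrite (negPf as_).
apply/seteqP; split=> [x h|x].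
  have [e|e] := boolP (bit a x); [left|right] => l; rewrite inE => /orP[/eqP->|ls].
  - by rewrite e /v' eqxx.
  - by rewrite va// h.
  - by rewrite (negPf e) /v' eqxx.
  - by rewrite va// h.
by move=> [] h l ls; have := h l; rewrite inE ls orbT va//; apply.
Qed.

End RandomBits.

Section GeneratedIndependence.
Context (R : realType) (dO dB : measure_display) (Omega : measurableType dO)
  (P : probability Omega R) (B : measurableType dB) (Y : int -> {RV P >-> B}).
Variable G : set (set B).
Hypotheses (mG : measurable = <<s G >>) (GI : setI_closed G) (GT : G setT).

Let prod_formula (s : seq int) (A : int -> set B) :=
  P (\bigcap_(i in [set` s]) (Y i @^-1` A i)) = (\prod_(i <- s) P (Y i @^-1` A i))%E.

(** Replace the generators by arbitrary measurable sets one coordinate at a time: with the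
    other sets fixed, both sides are finite measures in the set of that coordinate, and
    they agree on a generating family that is closed under intersection. *)
Lemma independent_generated :
  (forall s A, uniq s -> (forall i, i \in s -> G (A i)) -> prod_formula s A) ->
  mutually_independent Y.
Proof.
move=> GP.
have mGm E : G E -> measurable E by move=> GE; rewrite mG; exact: sub_sigma_algebra.
have mY i E : measurable E -> measurable (Y i @^-1` E).
  by move=> mE; rewrite -[X in measurable X]setTI; exact: (@measurable_funPT _ _ _ _ (Y i)).
have mcap (r : seq int) A : (forall i, measurable (A i)) ->
    measurable (\bigcap_(i in [set` r]) (Y i @^-1` A i)).
  move=> mA; apply: fin_bigcap_measurable => [|i _]; last exact: mY.
  exact: finite_seq.
have claim s1 s2 A : uniq (s1 ++ s2) -> (forall i, measurable (A i)) ->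
    (forall i, i \in s2 -> G (A i)) -> prod_formula (s1 ++ s2) A.
  elim: s1 s2 A => [|a s1 IH] s2 A us mA GA; first exact: GP.
  pose t := s1 ++ s2.
  pose C := \bigcap_(i in [set` t]) (Y i @^-1` A i).
  have mC : measurable C by exact: mcap.
  have at_ : a \notin t by move: us => /= /andP[].
  have [c Cc] : exists c : R, P C = c%:E.
    by exists (fine (P C)); rewrite fineK ?fin_num_measure.
  have c0 : 0 <= c by rewrite -lee_fin -Cc.
  (* Putting E in place of A a only affects the factor of index a. *)
  have CE E : (\bigcap_(i in [set` a :: t]) (Y i @^-1` (if i == a then E else A i))) =
      Y a @^-1` E `&` C.
    rewrite (_ : [set` a :: t] = a |` [set` t]); last first.
      apply/seteqP; split=> i /=; rewrite inE; first by case/orP=> [/eqP|]; [left|right].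
      by case=> [->|->]; rewrite ?eqxx ?orbT.
    rewrite bigcap_setU1 eqxx; congr (_ `&` _).
    apply: eq_bigcapr => i /= it; case: eqP => // ia.
    by rewrite ia (negPf at_) in it.
  have PC : P C = (\prod_(i <- t) P (Y i @^-1` A i))%E.
    by apply: IH => //; have := us => /= /andP[].
  have GE E : G E -> P (Y a @^-1` E `&` C) = (P (Y a @^-1` E) * P C)%E.
    move=> GE; have /= := IH (a :: s2) (fun i => if i == a then E else A i).
    have pm : perm_eq (s1 ++ a :: s2) (a :: t) by rewrite -cat1s perm_catCA.
    have es : [set` s1 ++ a :: s2] = [set` a :: t].
      by apply/seteqP; split=> i /=; rewrite (perm_mem pm).
    rewrite /prod_formula (perm_big _ pm) big_cons eqxx es CE => -> //.
    - rewrite PC; congr (_ * _)%E; rewrite big_seq [RHS]big_seq; apply: eq_bigr => i it.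
      by case: eqP => // ia; rewrite ia (negPf at_) in it.
    - by rewrite (perm_uniq pm).
    - by move=> i; case: eqP => // _; exact: mGm.
    - by move=> i; rewrite inE; case: eqP => //= _; exact: GA.
  have step E : measurable E -> P (Y a @^-1` E `&` C) = (c%:E * P (Y a @^-1` E))%E.
    move=> mE.
    transitivity (pushforward (mrestr P mC) (Y a) E) => //.
    transitivity (mscale (NngNum c0) (distribution P (Y a)) E) => //.
    apply: (@measure_unique _ _ B G (fun=> setT)) => //.
    - by rewrite bigcup_const.
    - by move=> E' /GE; rewrite Cc muleC.
    - move=> _; apply: (@le_lt_trans _ _ 1%E); last exact: ltry.
      by apply: (@probability_le1 _ _ _ P); apply: measurableI => //; exact: mY.
  have e : \bigcap_(i in [set` a :: t]) (Y i @^-1` A i) = Y a @^-1` A a `&` C.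
    by rewrite -CE; apply: eq_bigcapr => i _; case: eqP => // ->.
  rewrite /prod_formula /= e step; last exact: mA.
  by rewrite -Cc PC big_cons muleC.
by move=> s A us mA; rewrite -[s]cats0; apply: claim; rewrite ?cats0.
Qed.

End GeneratedIndependence.

Section BitProcess.
Variable R : realType.

Let P : probability (measurableTypeR R) R := uniform_prob (@ltr01 R).

(** The injection [pickle] of pairs into [nat] distributes the digits of one uniform
    variable over all sites. *)
Definition bits_at (i : int) (x : measurableTypeR R) : bitseqs :=
  fun j => bit (pickle (i, j)) x.

Lemma bits_at_cyl i n v : bits_at i @^-1` bit_cyl n v =
  [set x | forall l, l \in [seq pickle (i, j) | j <- iota 0 n] ->
     bit l x = oapp (fun ij : int * nat => v ij.2) true (unpickle l)].
Proof.
apply/seteqP; split=> x h.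
  by move=> _ /mapP[j + ->]; rewrite mem_iota pickleK /= => jn; exact: h.
move=> j jn; rewrite /bits_at h ?pickleK//; apply/mapP; exists j => //.
by rewrite mem_iota.
Qed.

Lemma measurable_bits_at i : measurable_fun setT (bits_at i).
Proof.
apply: (@measurability _ _ _ bitseqs setT (bits_at i) bit_cyls) => //.
move=> _ [_ [->|[n [v ->]]] <-]; first by rewrite preimage_set0 setI0; exact: measurable0.
by rewrite setTI bits_at_cyl; exact: measurable_bits.
Qed.

Definition bit_process (i : int) : {RV P >-> bitseqs} :=
  mfun_Sub (mem_set (measurable_bits_at i)).

Lemma bit_process_cyls (s : seq int) (n : int -> nat) (v : int -> nat -> bool) :
  uniq s ->
  P (\bigcap_(i in [set` s]) (bit_process i @^-1` bit_cyl (n i) (v i))) =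
  (\prod_(i <- s) ((2 ^+ n i)^-1)%:E)%E.
Proof.
move=> us; pose L := [seq pickle (i, j) | i <- s, j <- iota 0 (n i)].
have uL : uniq L.
  apply: allpairs_uniq_dep => // [i _|]; first exact: iota_uniq.
  by move=> [i j] [i' j'] _ _ /= /(pcan_inj pickleK) [-> ->].
rewrite (_ : \bigcap_(i in _) _ = [set x | forall l, l \in L ->
    bit l x = oapp (fun ij : int * nat => v ij.1 ij.2) true (unpickle l)]).
  rewrite prob_bits// size_allpairs_dep; elim: s {us L uL} => [|i s IH] /=.
    by rewrite big_nil expr0 invr1.
  by rewrite big_cons -IH size_iota exprD invfM EFinM.
apply/seteqP; split=> x h.
  move=> _ /allpairsPdep[i [j [si jn ->]]]; rewrite pickleK /=.
  by apply: (h i si); rewrite mem_iota in jn.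
move=> i si j jn; rewrite /= /bits_at h ?pickleK//.
by apply/allpairsPdep; exists i, j; rewrite mem_iota.
Qed.

Lemma bit_process_cyl i n v : P (bit_process i @^-1` bit_cyl n v) = ((2 ^+ n)^-1)%:E.
Proof.
have := @bit_process_cyls [:: i] (fun=> n) (fun=> v) isT.
rewrite big_seq1 => <-; congr (P _).
by apply/seteqP; split=> x h; [move=> j; rewrite /= inE => /eqP-> | apply: h; rewrite /= inE].
Qed.

Lemma bit_process_independent : mutually_independent bit_process.
Proof.
apply: (@independent_generated R _ _ (measurableTypeR R) P bitseqs bit_process bit_cyls) => //.
- exact: bit_cylsI.
- by right; exists 0%N, (fun=> true); apply/seteqP; split.
move=> s A us GA.
have [[i si Ai]|no0] := pselect (exists2 i, i \in s & A i = set0).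
  rewrite (_ : \bigcap_(i in _) _ = set0).
    by rewrite measure0 (big_rem i)//= Ai preimage_set0 measure0 mul0e.
  by apply/seteqP; split=> // x /(_ i si); rewrite Ai.
have /choice[n nP] : forall i : int, exists n, i \in s -> exists v, A i = bit_cyl n v.
  move=> i; have [si|si] := boolP (i \in s); last by exists 0%N.
  by case: (GA i si) => [Ai|[n [v Av]]]; [case: no0; exists i | exists n => _; exists v].
have /choice[v vP] : forall i : int, exists v, i \in s -> A i = bit_cyl (n i) v.
  move=> i; have [si|si] := boolP (i \in s); last by exists (fun=> true).
  by have [v Av] := nP i si; exists v.
transitivity (P (\bigcap_(i in [set` s]) (bit_process i @^-1` bit_cyl (n i) (v i)))).
  by congr (P _); apply: eq_bigcapr => i si; rewrite vP.
rewrite bit_process_cyls// big_seq [RHS]big_seq; apply: eq_bigr => i si.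
by rewrite vP// bit_process_cyl.
Qed.

Lemma bit_process_iid : iid bit_process.
Proof.
split; first exact: bit_process_independent.
move=> i j A mA; apply: (@measure_unique _ _ bitseqs bit_cyls (fun=> setT)) => //.
- exact: bit_cylsI.
- by move=> _; right; exists 0%N, (fun=> true); apply/seteqP; split.
- by rewrite bigcup_const.
- move=> E [->|[n [v ->]]]; first by rewrite !measure0.
  by transitivity (((2 ^+ n)^-1)%:E : \bar R); [|apply/esym]; exact: bit_process_cyl.
- by move=> _; rewrite ltey_eq fin_num_measure.
Qed.

End BitProcess.

Section BitMeasurability.

Lemma fiber_measurable_bit (l : nat) : fiber_measurable (fun b : bitseqs => b l).
Proof.
move=> c; rewrite (_ : _ @^-1` _ = \bigcup_(p in [set p : {ffun 'I_l.+1 -> bool} | p ord_max = c])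
    bit_cyl l.+1 (fun j => p (inord j))).
  apply: fin_bigcup_measurable => [|p _]; last exact: measurable_bit_cyl.
  exact: finite_finset.
apply/seteqP; split=> [b bc|b [p /= pc bp]].
  exists [ffun j : 'I_l.+1 => b j]; first by rewrite /= ffunE.
  by move=> j jl; rewrite ffunE inordK.
by rewrite bp// -pc; congr (p _); apply/val_inj; rewrite /= inordK.
Qed.

(** Such a map factors through finitely many bits. *)
Lemma fiber_measurable_bits_local (T : finType) (f : path_space bitseqs -> T) (n N : nat) :
  (forall y y' : path_space bitseqs,
     (forall i : int, `|i| <= n%:Z -> forall b, (b < N)%N -> y i b = y' i b) -> f y = f y') ->
  fiber_measurable f.
Proof.
move=> floc; pose pr (y : path_space bitseqs) :=
  [ffun i : 'I_(n.*2.+1) => [ffun b : 'I_N => y (i%:Z - n%:Z) b]].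
have mpr : fiber_measurable pr.
  apply: fiber_measurable_ffun => i; apply: fiber_measurable_ffun => b.
  exact: (fiber_measurable_pre (fiber_measurable_bit b) (@measurable_coord _ bitseqs (i%:Z - n%:Z))).
move=> a; rewrite (_ : _ @^-1` _ = [set y | exists y', pr y' = pr y /\ f y' = a]).
  exact: (fiber_measurable_set (fun p => exists y', pr y' = p /\ f y' = a) mpr).
apply/seteqP; split=> [y fy|y [y' [ppy fy']]]; first by exists y.
rewrite /= -fy'; apply: floc => i it b bN.
have it' : (absz (i + n%:Z)%R < n.*2.+1)%N by lia.
have := congr1 (fun g : {ffun _ -> {ffun 'I_N -> bool}} => g (Ordinal it') (Ordinal bN)) ppy.
by rewrite !ffunE /= (_ : _ - n%:Z = i)//; lia.
Qed.

End BitMeasurability.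

Lemma fiber_measurable_asbool d (S : measurableType d) (E : set S) :
  measurable E -> fiber_measurable (fun z => `[< E z >]).
Proof.
move=> mE [].
  by rewrite (_ : _ @^-1` _ = E)//; apply/seteqP; split=> y /= /asboolP.
rewrite (_ : _ @^-1` _ = ~` E); first exact: measurableC.
by apply/seteqP; split=> y /=; [move=> /negbT/asboolP | move=> nE; apply/negbTE/asboolP].
Qed.

(** * From a local rule to a factor with explicit coding radius *)

Section Realize.
Variables (q : nat) (a0 a1 : 'I_q).
Hypothesis a01 : a0 != a1.
Variable rule : nat -> (int -> bitseqs) -> option 'I_q.
Hypothesis rule_bits : forall n, exists N, forall y y',
  (forall i : int, `|i| <= n%:Z -> forall b, (b < N)%N -> y i b = y' i b) ->
  rule n y = rule n y'.
Implicit Types y : int -> bitseqs.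

Let rule_loc n y y' : (forall i : int, `|i| <= n%:Z -> y i = y' i) -> rule n y = rule n y'.
Proof. by move=> yy'; have [N] := rule_bits n; apply => i /yy' ->. Qed.

(** The two constant sequences: they have probability zero, and any site can be made to
    carry either. *)
Definition signal (c : bool) (b : bitseqs) := forall l, b l = c.

(** Only the site [n] on the right can signal at distance [n]. *)
Definition signalled_rule n y : option 'I_q :=
  if `[< signal true (y n%:Z) >] then Some a1
  else if `[< signal false (y n%:Z) >] then Some a0 else rule n y.

(** The answer of the least distance at which there is one. *)
Fixpoint search n y : option 'I_q :=
  if n is n'.+1 then (if search n' y is Some v then Some v else signalled_rule n y)
  else signalled_rule 0 y.

(** The value [a0] is that of a search that never succeeds. *)
Definition output y : 'I_q :=
  if pselect (exists n, search n y <> None) is left h then odflt a0 (search (projT1 (cid h)) y)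
  else a0.

Definition factor y (i : int) : 'I_q := output (translate i y).

Lemma search_mono n n' y v : (n <= n')%N -> search n y = Some v -> search n' y = Some v.
Proof. by move=> /subnK <- rv; elim: (n' - n)%N => //= m ->. Qed.

Lemma search_output n y v : search n y = Some v -> output y = v.
Proof.
move=> rv; rewrite /output; case: pselect => [h|[]]; last by exists n; rewrite rv.
case: (cid h) => m /=; case e: (search m y) => [v'|] // _ /=.
by have [nm|/ltnW mn] := leqP n m;
  [have := search_mono nm rv; rewrite e => -[] | have := search_mono mn e; rewrite rv => -[]].
Qed.

Lemma output_none y : (forall n, search n y = None) -> output y = a0.
Proof. by move=> rn; rewrite /output; case: pselect => // h; exfalso; case: h => n; rewrite rn. Qed.

Lemma factor_equivariant : translation_equivariant factor.
Proof.
move=> n y; apply/funext => i; rewrite /factor /translate /=; congr output.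
by apply/funext => j; congr (y _); lia.
Qed.

Lemma search_local n y y' : (forall i : int, `|i| <= n%:Z -> y i = y' i) -> search n y = search n y'.
Proof.
elim: n => [|n IH] /= yy'; first by rewrite /signalled_rule yy' ?(rule_loc yy').
rewrite IH; last by move=> i ni; apply: yy'; lia.
by rewrite /signalled_rule yy' ?(rule_loc yy')//; lia.
Qed.

Lemma factor0 y : factor y 0 = output y.
Proof. by congr output; apply/funext => i; rewrite /translate addr0. Qed.

(** If the search has not stopped at distance [n], placing one signal or the other at
    [n + 1] yields two configurations that agree with [y] up to distance [n] and have
    different letters. *)
Lemma determinedP y n : determined_within factor y n <-> search n y <> None.
Proof.
split=> [dn rn|rn]; last first.
  move=> y' yy'; case e: (search n y) rn => [v|] // _.
  by rewrite !factor0 (search_output e) (@search_output n _ v)// -e; exact: search_local.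
(* z c carries the signal c just out of sight. *)
pose z (c : bool) : int -> bitseqs := fun i => if i == n.+1%:Z then (fun=> c) else y i.
have zy c i : `|i| <= n%:Z -> z c i = y i by rewrite /z; case: eqP => // ->; lia.
have rz c : search n.+1 (z c) = Some (if c then a1 else a0).
  rewrite /= (search_local (zy c)) rn /signalled_rule /signal /z eqxx.
  by case: c; [rewrite asboolT | rewrite asboolF ?asboolT// => /(_ 0%N)].
move/eqP: a01; apply; have := dn _ (zy true); rewrite -(dn _ (zy false)).
by rewrite !factor0 (search_output (rz true)) (search_output (rz false)).
Qed.

Lemma fiber_measurable_rule n : fiber_measurable (rule n : path_space bitseqs -> option 'I_q).
Proof. by have [N ruleN] := rule_bits n; exact: fiber_measurable_bits_local ruleN. Qed.

Lemma measurable_signal c (i : int) :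
  measurable [set y : path_space bitseqs | signal c (y i)].
Proof.
rewrite (_ : [set y | _] = \bigcap_l [set y : path_space bitseqs | y i l = c]).
  apply: bigcapT_measurable => l.
  exact: (fiber_measurable_pre (fiber_measurable_bit l) (@measurable_coord _ bitseqs i) c).
by apply/seteqP; split=> y h l; [move=> _; exact: h | exact: h].
Qed.

Lemma fiber_measurable_search n : fiber_measurable (search n : path_space bitseqs -> option 'I_q).
Proof.
have mb m : fiber_measurable (signalled_rule m : path_space bitseqs -> option 'I_q).
  have m1 := fiber_measurable_asbool (measurable_signal true m%:Z).
  have m2 := fiber_measurable_asbool (measurable_signal false m%:Z).
  have m3 := fiber_measurable_pair m1 (fiber_measurable_pair m2 (fiber_measurable_rule m)).
  exact: (@fiber_measurable_comp _ _ (bool * (bool * option 'I_q))%type (option 'I_q) _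
    (fun p => if p.1 then Some a1 else if p.2.1 then Some a0 else p.2.2) m3).
elim: n => [|n IH]; first exact: mb.
exact: (@fiber_measurable_comp _ _ (option 'I_q * option 'I_q)%type (option 'I_q) _
    (fun p => if p.1 is Some v then Some v else p.2) (fiber_measurable_pair IH (mb n.+1))).
Qed.

Lemma fiber_measurable_output : fiber_measurable (output : path_space bitseqs -> 'I_q).
Proof.
move=> v; rewrite (_ : _ @^-1` _ = (\bigcup_n search n @^-1` [set Some v]) `|`
    (if v == a0 then \bigcap_n search n @^-1` [set None] else set0)).
  apply: measurableU; first by apply: bigcupT_measurable => n; exact: fiber_measurable_search.
  by case: ifP => // _; apply: bigcapT_measurable => n; exact: fiber_measurable_search.
apply/seteqP; split=> y.
  move=> /= oy; have [rn|h] := pselect (forall n, search n y = None).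
    by right; rewrite -oy output_none// eqxx => n _; exact: rn.
  have [n] : exists n, search n y <> None by apply/existsNP.
  case e: (search n y) => [v'|] // _; left; exists n => //=.
  by rewrite -oy (search_output e).
move=> [[n _ /= /search_output//]|]; case: eqP => // -> h.
by apply: output_none => n; exact: h.
Qed.

Lemma measurable_factor : measurable_map (factor : (int -> bitseqs) -> _).
Proof.
move=> E; suff h : <<s cylinders [set: set 'I_q] >> `<=`
    [set E | measurable (factor @^-1` E : set (path_space bitseqs))] by exact: h.
apply: smallest_sub; last first.
  move=> _ [i _ [A _ <-]] /=; rewrite setTI.
  have mo := fiber_measurable_pre fiber_measurable_output (@measurable_translate _ bitseqs i).
  exact: (fiber_measurable_set A mo).
split=> /=.
- by rewrite preimage_set0.
- by move=> A mA; rewrite setTD preimage_setC; exact: measurableC.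
- by move=> A mA; rewrite preimage_bigcup; exact: bigcupT_measurable.
Qed.

End Realize.

(** * Probability of failure *)

Section Growth.
Variable R : realType.

(** An integer majorant of the tower, as [expR 1 <= 4]. *)
Fixpoint tower4 (n : nat) : nat := if n is n'.+1 then (4 ^ tower4 n')%N else 1%N.

Lemma expR1_le4 : expR 1 <= 4 :> R.
Proof.
have h : expR (2^-1) <= 2 :> R.
  have := expR_ge1Dx (- 2^-1 : R); rewrite expRN (_ : 1 - 2^-1 = 2^-1); last by field.
  by rewrite lef_pV2 ?posrE ?expR_gt0.
rewrite [X in expR X](_ : 1 = 2^-1 + 2^-1 :> R) ?expRD; last by field.
rewrite (_ : 4 = 2 * 2 :> R); last by ring.
by apply: ler_pM => //; exact: expR_ge0.
Qed.

Lemma tower_nat_le4 n : tower_nat R n <= (tower4 n)%:R.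
Proof.
elim: n => [|n IH] //; rewrite tower_natS [tower4 _]/= natrX.
apply: (@le_trans _ _ (expR (tower4 n)%:R)); first by rewrite ler_expR.
rewrite -[X in expR X]mul1r expRM_natr lerXn2r ?nnegrE ?expR_ge0//.
exact: expR1_le4.
Qed.

Lemma tower4_gt0 n : (0 < tower4 n)%N.
Proof. by case: n => //= n; rewrite expn_gt0. Qed.

(** The factor 12 makes the induction close: 12 towers in the exponent give 6 of them
    after halving, and [2 ^ 6 = 4 * 2 ^ 4], where [2 ^ 4 >= 12]. *)
Lemma tower4_label_size n : (12 * tower4 n <= 2 ^ label_size n)%N.
Proof.
elim: n => [//|n IH]; have t0 := tower4_gt0 n.
have h : (6 * tower4 n <= label_size n.+1)%N by have := double_label_sizeS n; lia.
apply: (@leq_trans (2 ^ (6 * tower4 n))); last by rewrite leq_exp2l.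
rewrite [tower4 _]/= (_ : 6 * tower4 n = 2 * tower4 n + 4 * tower4 n)%N; last lia.
rewrite expnD mulnC expnM leq_mul2l.
have -> : (12 <= 2 ^ (4 * tower4 n))%N; last by rewrite orbT.
by apply: (@leq_trans (2 ^ 4)) => //; rewrite leq_exp2l//; lia.
Qed.

Lemma label_size_ge n : (4 + n.*2 <= label_size n)%N.
Proof.
elim: n => //= n IH.
have [m em] : exists m, label_size n = (m + 4)%N by exists (label_size n - 4)%N; lia.
rewrite em (_ : (m + 4).-1 = m + 3)%N ?expnD; last lia.
have := ltn_expl m (leqnn 2); lia.
Qed.

Lemma leq_tower4 m n : (m <= n)%N -> (tower4 m <= tower4 n)%N.
Proof.
move=> /subnK <-; elim: (n - m)%N => // j IH; rewrite addSn /=.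
by apply: (leq_trans IH); apply: ltnW; exact: ltn_expl.
Qed.

(** One more exponential is worth a square: [2 ^ label_size S.+1] is at least the square of
    [2 ^ label_size S], one factor of which beats the tower and the other the linear
    term. *)
Lemma label_size_growth K : exists m0, forall S u, (u + m0 <= S)%N ->
  (K * S.+2 * tower4 u <= 2 ^ label_size S)%N.
Proof.
exists K.+1 => -[|S] u uS; first lia.
have h1 : (tower4 u <= 2 ^ label_size S)%N.
  have := tower4_label_size S; have : (tower4 u <= tower4 S)%N by apply: leq_tower4; lia.
  lia.
have h2 : (K * S.+3 <= 2 ^ label_size S)%N.
  apply: (@leq_trans (2 ^ S * 2 ^ (S + 3))).
    apply: leq_mul; first by apply: (@leq_trans S); [lia | exact/ltnW/ltn_expl].
    by apply: ltnW; rewrite -addn3; exact: ltn_expl.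
  by rewrite -expnD leq_exp2l//; have := label_size_ge S; lia.
apply: (@leq_trans (2 ^ label_size S * 2 ^ label_size S)); first exact: leq_mul.
rewrite -expnD leq_exp2l// addnn /=.
have [m em] : exists m, label_size S = (m + 4)%N.
  by exists (label_size S - 4)%N; have := label_size_ge S; lia.
rewrite em (_ : (m + 4).-1 = m + 3)%N ?expnD; last lia.
have := ltn_expl m (leqnn 2); lia.
Qed.

End Growth.

Section FailureProbability.
Variable R : realType.

Let P : probability (measurableTypeR R) R := uniform_prob (@ltr01 R).
Let Y := bit_process R.

Definition label_event (N : nat) (i j : int) : set (measurableTypeR R) :=
  [set x | label N (path Y x i) = label N (path Y x j)].

Lemma label_eventE N i j : label_event N i j =
  \bigcup_(v in [set: {ffun 'I_N -> bool}])
    (bits_at (R := R) i @^-1` bit_cyl N (fun l => if insub l is Some o then v o else true) `&`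
     bits_at j @^-1` bit_cyl N (fun l => if insub l is Some o then v o else true)).
Proof.
apply/seteqP; split=> [x e|x [v _ [hi hj]]].
  exists [ffun l : 'I_N => bits_at i x l] => //; split=> l lN.
    by rewrite insubT ffunE.
  by rewrite insubT ffunE; apply/esym; exact: (label_inj e).
by apply: eq_label => l lN; apply: etrans (hi l lN) (esym (hj l lN)).
Qed.

Lemma measurable_bits_pre i n v : measurable (bits_at (R := R) i @^-1` bit_cyl n v).
Proof.
rewrite -[X in measurable X]setTI; apply: measurable_bits_at => //.
exact: measurable_bit_cyl.
Qed.

Lemma measurable_label_event N i j : measurable (label_event N i j).
Proof.
rewrite label_eventE; apply: fin_bigcup_measurable => // v _.
by apply: measurableI; exact: measurable_bits_pre.
Qed.

(** There are [2 ^ N] common values of the first [N] bits. *)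
Lemma prob_label_event N i j : i != j -> (P (label_event N i j) <= ((2 ^+ N)^-1)%:E)%E.
Proof.
move=> ij; pose E (v : {ffun 'I_N -> bool}) :=
  \bigcap_(l in [set` [:: i; j]]) (bit_process R l @^-1`
     bit_cyl N (fun l => if insub l is Some o then v o else true)).
have PE v : P (E v) = ((2 ^+ N)^-1 * (2 ^+ N)^-1)%:E.
  rewrite /P /E (@bit_process_cyls _ [:: i; j] (fun=> N)
    (fun _ l => if insub l is Some o then v o else true)).
    by rewrite big_cons big_seq1 EFinM.
  by rewrite /= inE ij.
apply: (@le_trans _ _ (\sum_(v <- enum {ffun 'I_N -> bool}) P (E v))%E).
  apply: union_bound; last first.
  - move=> x; rewrite label_eventE => -[v _ [hi hj]]; exists v; rewrite ?mem_enum//.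
    by move=> l; rewrite /= !inE => /orP[/eqP->|/eqP->].
  - exact: measurable_label_event.
  - move=> v _; apply: fin_bigcap_measurable => [|l _]; first exact: finite_seq.
    exact: measurable_bits_pre.
rewrite (eq_bigr _ (fun v _ => PE v)) big_enum /= sumEFin sumr_const card_ffun card_bool card_ord.
by rewrite lee_fin -[leLHS]mulr_natl natrX mulrA mulfV ?mul1r// expf_neq0.
Qed.

Lemma prob_signal c i : P [set x | signal c (path Y x i)] = 0%E.
Proof.
set E := [set x | _].
have mE : measurable E.
  have := @measurable_path _ _ _ _ _ _ Y measurableT _ (measurable_signal c i).
  by rewrite setTI.
have h n : (P E <= ((2 ^+ n)^-1)%:E)%E.
  rewrite -(bit_process_cyl R i n (fun=> c)); apply: le_measure; rewrite ?inE//.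
    exact: measurable_bits_pre.
  by move=> x Ex l _; exact: Ex.
apply/eqP; rewrite eq_le measure_ge0 andbT.
apply/lee_addgt0Pr => e e0; rewrite add0e.
have n1 : e^-1 < (Num.truncn e^-1).+1%:R by exact: truncnS_gt.
apply: le_trans (h (Num.truncn e^-1).+1) _; rewrite lee_fin.
rewrite -[leRHS]invrK lef_pV2 ?posrE ?exprn_gt0 ?invr_gt0//.
by apply: (le_trans (ltW n1)); rewrite -natrX ler_nat ltnW// ltn_expl.
Qed.

Variables (t0 m0 q : nat) (p : nat -> int -> 'I_q).
Hypothesis t00 : (0 < t0)%N.

(** Union bound over the sites [i] of the window, the distances [d] and the positions [j] in
    the progression of step [d].  The range of [d] is taken to be [1, ..., t0] for a round
    count; the term [d = t0] is empty. *)
Lemma prob_rule_none n S : (0 < stage t0 m0 n)%N -> S = ((stage t0 m0 n).-1 + m0)%N ->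
  (P [set x | rule t0 m0 p n (path Y x) = None] <=
    (((4 * t0).+1 * t0 * S.+2)%N%:R / 2 ^+ label_size S)%:E)%E.
Proof.
move=> s0 SE.
pose I := [seq (i, dj) | i <- window_sites t0, dj <- [seq (d, j) | d <- iota 1 t0, j <- iota 0 S.+2]].
pose E (idj : int * (nat * nat)) := if (idj.2.1 < t0)%N then
  label_event (label_size S) (idj.1 - idj.2.1%:Z + idj.2.1%:Z *+ idj.2.2)
    (idj.1 - idj.2.1%:Z + idj.2.1%:Z *+ idj.2.2.+1) else set0.
apply: (@le_trans _ _ (\sum_(idj <- I) P (E idj))%E).
  apply: union_bound.
  - by move=> idj _; rewrite /E; case: ifP => // _; exact: measurable_label_event.
  - have [N ruleN] := rule_local_bits m0 t00 p n.
    have ma := fiber_measurable_bits_local ruleN.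
    have := @measurable_path _ _ _ _ _ _ Y measurableT _ (ma None).
    by rewrite setTI.
  - move=> x /= none; apply: contrapT => nE.
    have : complete t0 m0 (stage t0 m0 n) (path Y x).
      apply/allP => i iw; rewrite -(prednK s0); apply: markers_blocked => //; rewrite -SE => d j dt jS.
      apply/eqP => e; apply: nE; exists (i, (d, j)); last first.
        by rewrite /E /=; have /andP[_ ->] := dt.
      by apply: allpairs_f => //; apply: allpairs_f; rewrite mem_iota; lia.
    by move: none; rewrite /rule => + cs; rewrite cs.
apply: (@le_trans _ _ (\sum_(idj <- I) ((2 ^+ label_size S)^-1)%:E)%E).
  rewrite !big_seq; apply: lee_sum => _ /allpairsPdep[i [_ [_ /allpairsPdep[d [j [d1 _ ->]]] ->]]].
  move: d1; rewrite mem_iota /E /= => d1.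
  case: ifP => // _; last by rewrite measure0 lee_fin invr_ge0 exprn_ge0.
  by apply: prob_label_event; rewrite mulrSr; lia.
rewrite sumEFin big_const_seq count_predT iter_addr_0 lee_fin -[leLHS]mulr_natl.
by rewrite !size_allpairs !size_map !size_iota mulnA.
Qed.

End FailureProbability.

Lemma measurable_radius (R : realType) (dO dB : measure_display)
    (Omega : measurableType dO) (P : probability Omega R) (B : measurableType dB)
    (Y : int -> {RV P >-> B}) (q : nat) (F : (int -> B) -> (int -> 'I_q)) :
  (forall n, measurable [set w | determined_within F (path Y w) n]) ->
  measurable_fun setT (radius Y F).
Proof.
move=> mdet; apply: (measurability _ (ErealGenOInfty.measurableE R)) => //.
move=> _ [_ [r ->] <-]; rewrite setTI.
have rE w : (radius Y F @^-1` `]r%:E, +oo[%classic) w <-> (r%:E < radius Y F w)%E.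
  by rewrite /= in_itv /= andbT.
have [r0|r0] := ltP r 0.
  rewrite (_ : _ @^-1` _ = setT); first exact: measurableT.
  apply/seteqP; split=> // w _; apply/rE; apply: (@lt_le_trans _ _ 0%E); first by rewrite lte_fin.
  by apply: le_ereal_inf_tmp => _ [n _ <-]; rewrite lee_fin.
rewrite (_ : _ @^-1` _ = ~` [set w | determined_within F (path Y w) (Num.truncn r)]).
  exact: measurableC.
by apply/seteqP; split=> w /=; [move/rE/lt_coding_radius; apply | move=> h; apply/rE/lt_coding_radius].
Qed.

Lemma stage_ge t0 m0 u n : (0 < t0)%N -> (0 < u)%N ->
  (u * (t0 * (#|{ffun 'I_t0 -> 'I_16}|.+1.*2 + m0 + 7)) <= n)%N -> (u < stage t0 m0 n)%N.
Proof.
rewrite /stage; set M := #|_|.+1; have : (0 < M)%N by [].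
move: M => M M0 t00 u0 un; rewrite leq_divRL//.
have : (u * (M.*2 + m0 + 7) <= n %/ t0)%N by rewrite leq_divRL//; move: un; lia.
nia.
Qed.

(** * The upper bound *)

Section UpperBound.
Variables (R : realType) (q k : nat) (W : {set k.-tuple 'I_q}) (w : k.-tuple 'I_q).
Variables (t0 m0 : nat) (p : nat -> int -> 'I_q) (a0 a1 : 'I_q).
Hypotheses (t00 : (0 < t0)%N) (k0 : (0 < k)%N) (t0k : (k <= t0)%N) (a01 : a0 != a1).
Hypothesis pP : forall t, (t0 <= t)%N ->
  [/\ shift_ft W (p t), window k (p t) 0 = w & window k (p t) t%:Z = w].
Hypothesis m0P : forall S u, (u + m0 <= S)%N ->
  ((4 * t0).+1 * t0 * S.+2 * tower4 u <= 2 ^ label_size S)%N.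

Let P : probability (measurableTypeR R) R := uniform_prob (@ltr01 R).
Let Y := bit_process R.
Let A n (y : path_space bitseqs) := rule t0 m0 p n y.
Let Abits n : exists N, forall y y' : int -> bitseqs,
  (forall i : int, `|i| <= n%:Z -> forall b, (b < N)%N -> y i b = y' i b) ->
  A n y = A n y'.
Proof. exact: rule_local_bits. Qed.
Let F := factor a0 a1 A.
Let C := (t0 * (#|{ffun 'I_t0 -> 'I_16}|.+1.*2 + m0 + 7))%N.

Let mA n : measurable [set x | A n (path Y x) = None].
Proof.
have := @measurable_path _ _ _ _ _ _ Y measurableT _ (fiber_measurable_rule Abits n None).
by rewrite setTI.
Qed.

Lemma prob_rule_tower u n : (0 < u)%N -> (u * C <= n)%N ->
  (P [set x | A n (path Y x) = None] <= ((tower_nat R u)^-1)%:E)%E.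
Proof.
move=> u0 un; have us := stage_ge t00 u0 un.
have s0 : (0 < stage t0 m0 n)%N by exact: leq_ltn_trans us.
apply: (le_trans (prob_rule_none R p t00 s0 erefl)); rewrite lee_fin.
set S := (_.-1 + m0)%N.
have := @m0P S u; rewrite leq_add2r -ltnS prednK// => /(_ us) h.
have T0 : 0 < tower_nat R u by exact: lt_le_trans (tower_nat_ge1 R u).
rewrite ler_pdivrMr ?exprn_gt0// mulrC ler_pdivlMr//.
apply: (@le_trans _ _ (((4 * t0).+1 * t0 * S.+2)%N%:R * (tower4 u)%:R)).
  by rewrite ler_wpM2l// tower_nat_le4.
by rewrite -natrM -natrX ler_nat.
Qed.

Lemma search_none n y : search a0 a1 A n y = None -> A n y = None.
Proof.
case: n => [|n] /=; [|case: (search _ _ _ n y) => //];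
  by rewrite /signalled_rule; case: ifP => // _; case: ifP.
Qed.

(** By stationarity it suffices to look at the origin, where the failure probability is
    below one over every tower. *)
Lemma rule_eventually (i : int) :
  {ae P, forall x, exists n, A n (translate i (path Y x)) <> None}.
Proof.
pose E : set (path_space bitseqs) := [set y | forall n, A n y = None].
have mE : measurable E.
  rewrite (_ : E = \bigcap_n [set y | A n y = None]).
    by apply: bigcapT_measurable => n; exact: fiber_measurable_rule.
  by apply/seteqP; split=> y h n; [move=> _; exact: h | exact: h].
have mEi : measurable (translate i @^-1` E : set (path_space bitseqs)).
  by rewrite -[X in measurable X]setTI; exact: measurable_translate.
exists (path Y @^-1` (translate i @^-1` E)); split.
- by rewrite -[X in measurable X]setTI; exact: (@measurable_path _ _ _ _ _ _ Y).
- rewrite -path_lawE (law_translate (iid_product_law (bit_process_iid R)) i mE) path_lawE.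
  apply/eqP; rewrite eq_le measure_ge0 andbT.
  apply/lee_addgt0Pr => e e0; rewrite add0e.
  set u := (Num.truncn e^-1).+1.
  have eu : e^-1 <= tower_nat R u.
    by apply: le_trans (tower_nat_id R u); apply: ltW; exact: truncnS_gt.
  apply: (@le_trans _ _ (P [set x | A (u * C) (path Y x) = None])).
    apply: le_measure; rewrite ?inE//; last by move=> x; apply.
    by rewrite -[X in measurable X]setTI; exact: (@measurable_path _ _ _ _ _ _ Y).
  apply: (le_trans (prob_rule_tower _ (leqnn _))) => //.
  by rewrite lee_fin -[leRHS]invrK lef_pV2 ?posrE ?invr_gt0// (lt_le_trans _ (tower_nat_ge1 R u)).
- by move=> x /= h n; apply: contrapT => An; apply: h; exists n.
Qed.

Lemma no_signal (i : int) c : {ae P, forall x, ~ signal c (path Y x i)}.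
Proof.
exists [set x | signal c (path Y x i)]; split; last by move=> x /= /contrapT.
- have := @measurable_path _ _ _ _ _ _ Y measurableT _ (measurable_signal c i).
  by rewrite setTI.
- exact: prob_signal.
Qed.

Lemma ae_int (Q : int -> measurableTypeR R -> Prop) :
  (forall i, {ae P, forall x, Q i x}) -> {ae P, forall x, forall i, Q i x}.
Proof.
move=> h.
have h1 : {ae P, forall x, forall n : nat, Q n%:Z x} by apply: ae_foralln.
have h2 : {ae P, forall x, forall n : nat, Q (- n%:Z) x} by apply: ae_foralln => n; exact: h.
move: h1 h2; apply: filterS2 => x h1 h2 i.
by case: (intP i) => [|n|n]; [exact: h1 | exact: h1 | exact: h2].
Qed.

(** Off a null set there is no signal, so all letters of a window come from the same
    stage of the markers. *)
Lemma factor_in_shift : {ae P, forall x, shift_ft W (F (path Y x))}.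
Proof.
have := ae_int rule_eventually.
have := ae_int (fun i => no_signal i true).
have := ae_int (fun i => no_signal i false).
apply: filterS3 => x ns0 ns1 ev i.
pose y := path Y x.
have searchA j n : search a0 a1 A n (translate j y) = A n (translate j y).
  have bA m : signalled_rule a0 a1 A m (translate j y) = A m (translate j y).
    rewrite /signalled_rule asboolF; last exact: ns1.
    by rewrite asboolF//; exact: ns0.
  elim: n => [|n IH] /=; first exact: bA.
  rewrite bA IH; case e: (A n _) => [v|] //.
  by apply/esym; exact: (rule_mono t00 (leqnSn n) e).
have /choice[n nP] : forall j : int, exists n, A n (translate j y) <> None by move=> j; exact: ev.
pose N := (\max_(j < k) n (i + j.+1%:Z)%R)%N.
apply: (@rule_sound t0 m0 t00 q k p W w k0 t0k pP N y) => j jk.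
have nN : (n (i + j.+1%:Z)%R <= N)%N by rewrite /N (bigD1 (Ordinal jk))//= leq_max leqnn.
case e: (A (n (i + j.+1%:Z)) (translate (i + j.+1%:Z) y)) (nP (i + j.+1%:Z)) => [v|] // _.
have := rule_mono t00 nN e; rewrite -/(A N _) => eN; rewrite -/(A N _) eN; congr Some.
apply/esym; rewrite /F /factor; apply: (@search_output _ _ _ _ N).
by rewrite searchA.
Qed.

Let msearch n : measurable [set x | search a0 a1 A n (path Y x) = None].
Proof.
have := @measurable_path _ _ _ _ _ _ Y measurableT _ (fiber_measurable_search a0 a1 Abits n None).
by rewrite setTI.
Qed.

Lemma factor_finitary : finitary Y F.
Proof.
pose E : set (path_space bitseqs) := [set y | forall n, search a0 a1 A n y = None].
have mE : measurable E.
  rewrite (_ : E = \bigcap_n [set y | search a0 a1 A n y = None]).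
    by apply: bigcapT_measurable => n; exact: (fiber_measurable_search a0 a1 Abits).
  by apply/seteqP; split=> y h n; [move=> _; exact: h | exact: h].
exists E; split => //.
- have [N [mN PN NE]] := rule_eventually 0.
  have mpE : measurable (path Y @^-1` E).
    by rewrite -[X in measurable X]setTI; exact: (@measurable_path _ _ _ _ _ _ Y).
  have EN : path Y @^-1` E `<=` N.
    move=> x Ex; apply: NE => -[n]; apply; apply: search_none.
    rewrite (_ : translate 0 _ = path Y x); first exact: Ex.
    by apply/funext => i; rewrite /translate addr0.
  apply/eqP; rewrite eq_le; apply/andP; split; last exact: (measure_ge0 P).
  have /le_trans : (P (path Y @^-1` E) <= P N)%E by apply: le_measure; rewrite ?inE.
  by apply; rewrite [leLHS](PN : P N = 0%E).
- move=> y /= h n; apply: contrapT => rn; apply: h; exists n.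
  exact/(determinedP a01 Abits).
Qed.

Lemma radius_tail (r : R) : 0 < r ->
  (P [set x | (r%:E < radius Y F x)%E] <= ((tower ((C%:R)^-1 * r))^-1)%:E)%E.
Proof.
move=> r0.
have C0 : 0 < C%:R :> R by rewrite ltr0n /C muln_gt0 t00 addn_gt0 orbT.
have radE : [set x | (r%:E < radius Y F x)%E] =
    [set x | search a0 a1 A (Num.truncn r) (path Y x) = None].
  apply/seteqP; split=> x /=.
    move/(lt_coding_radius _ _ (ltW r0)) => h; apply: contrapT => rn; apply: h.
    exact/(determinedP a01 Abits).
  move=> rn; apply/(lt_coding_radius _ _ (ltW r0)) => /(determinedP a01 Abits).
  by rewrite rn.
rewrite radE /tower; have [u0|u0] := posnP (Num.truncn (C%:R^-1 * r)).
  by rewrite u0 /tower_nat /= invr1; apply: (@probability_le1 _ _ _ P); exact: msearch.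
apply: le_trans (_ : P [set x | A (Num.truncn r) (path Y x) = None] <= _)%E.
  apply: le_measure; rewrite ?inE; [exact: msearch | exact: mA |].
  by move=> x; exact: search_none.
apply: prob_rule_tower => //; rewrite truncn_ge_nat ?(ltW r0)// natrM mulrC.
by rewrite -ler_pdivlMl// truncn_le mulr_ge0 ?invr_ge0 ?(ltW r0)// ltW.
Qed.

Lemma measurable_factor_radius : measurable_fun setT (radius Y F).
Proof.
apply: measurable_radius => n.
rewrite (_ : [set x | _] = ~` [set x | search a0 a1 A n (path Y x) = None]).
  exact: measurableC.
apply/seteqP; split=> x.
  by move=> /(determinedP a01 Abits).
by move=> h; apply/(determinedP a01 Abits).
Qed.

End UpperBound.

(** What the upper bound asserts for a given constant [c]. *)
Definition tower_tail (R : realType) (q k : nat) (W : {set k.-tuple 'I_q}) (c : R) : Prop :=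
  exists (dO dB : measure_display) (Omega : measurableType dO)
      (P : probability Omega R) (B : measurableType dB)
      (Y : int -> {RV P >-> B}) (F : (int -> B) -> (int -> 'I_q))
      (X : Omega -> int -> 'I_q),
      [/\ ffiid Y F X,
          {ae P, forall w, shift_ft W (X w)},
          measurable_fun [set: Omega] (radius Y F)
        & forall r : R, 0 < r ->
            (P [set w | (r%:E < radius Y F w)%E] <= ((tower (c * r))^-1)%:E)%E].

(** With one letter there is nothing to signal with, but the constant factor has radius
    0. *)
Lemma tower_upper_bound_unary (R : realType) (q k : nat) (W : {set k.-tuple 'I_q}) (a : 'I_q) :
  (forall b : 'I_q, b = a) -> shift_ft W (fun=> a) -> tower_tail W (1 : R).
Proof.
move=> qa Wa; pose P : probability (measurableTypeR R) R := uniform_prob (@ltr01 R).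
pose F (y : int -> bitseqs) (i : int) := a.
have det y n : determined_within F y n by [].
exists _, _, (measurableTypeR R), P, bitseqs, (bit_process R), F, (fun _ _ => a); split.
- split; [exact: bit_process_iid | | by [] | | by []]; last first.
    exists set0; split; [exact: measurable0 | exact: (measure0 P) |].
    by move=> y; apply; exists 0%N.
  move=> E _; have [Ea|Ea] := pselect (E (fun=> a)).
    rewrite (_ : _ @^-1` _ = setT); first exact: measurableT.
    by apply/seteqP; split.
  rewrite (_ : _ @^-1` _ = set0); first exact: measurable0.
  by apply/seteqP; split.
- exact: aeW.
- apply: measurable_radius => n; rewrite (_ : [set w | _] = setT) //.
  by apply/seteqP; split.
- move=> r r0; rewrite (_ : [set w | _] = set0) ?measure0 ?lee_fin ?invr_ge0.
    by rewrite (le_trans _ (tower_ge1 _)).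
  by apply/seteqP; split=> // w /= /(lt_coding_radius _ _ (ltW r0)); apply; exact: det.
Qed.

Lemma tower_upper_bound (R : realType) (q k : nat) (hq : (0 < q)%N) (hk : (0 < k)%N)
    (W : {set k.-tuple 'I_q}) : non_lattice W ->
  exists2 c : R, 0 < c & tower_tail W c.
Proof.
move=> [w wW gcdT]; have [n0 retT] := return_times_large gcdT.
pose t0 := (maxn k n0).
have t0k : (k <= t0)%N by exact: leq_maxl.
have t00 : (0 < t0)%N by exact: leq_trans t0k.
have /choice[p pP] : forall t, exists x, (t0 <= t)%N ->
    [/\ shift_ft W x, window k x 0 = w & window k x t%:Z = w].
  move=> t; have [tt|tt] := boolP (t0 <= t)%N; last by exists (fun=> Ordinal hq).
  by have [_ [x xP]] := retT t (leq_trans (leq_maxr _ _) tt); exists x.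
have [q1|q1] := leqP q 1.
  exists 1 => //; pose a := Ordinal hq.
  have qa (b : 'I_q) : b = a by apply/val_inj => /=; have := ltn_ord b; lia.
  apply: (@tower_upper_bound_unary R q k W a qa); have [Sp _ _] := pP t0 (leqnn _).
  by rewrite (_ : (fun=> a) = p t0)//; apply/funext => i; rewrite (qa (p t0 i)).
have [m0 m0P] := label_size_growth ((4 * t0).+1 * t0).
pose C := (t0 * (#|{ffun 'I_t0 -> 'I_16}|.+1.*2 + m0 + 7))%N.
exists (C%:R^-1); first by rewrite invr_gt0 ltr0n /C muln_gt0 t00 addn_gt0 orbT.
pose a0 := Ordinal hq; pose a1 := Ordinal q1; have a01 : a0 != a1 by [].
pose F : (int -> bitseqs) -> int -> 'I_q := factor a0 a1 (fun n y => rule t0 m0 p n y).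
have rule_b n : exists N, forall y y' : int -> bitseqs,
    (forall i : int, `|i| <= n%:Z -> forall b, (b < N)%N -> y i b = y' i b) ->
    rule t0 m0 p n y = rule t0 m0 p n y'.
  exact: rule_local_bits.
exists _, _, (measurableTypeR R), (uniform_prob (@ltr01 R)), bitseqs, (bit_process R), F,
  (fun x => F (path (bit_process R) x)); split.
- split; [exact: bit_process_iid | exact: measurable_factor | exact: factor_equivariant | |by []].
  exact: factor_finitary.
- exact: (@factor_in_shift _ _ _ W w).
- exact: measurable_factor_radius.
- exact: radius_tail.
Qed.

Theorem theorem3 (R : realType) (q k : nat) (hq : (0 < q)%N) (hk : (0 < k)%N)
    (W : {set k.-tuple 'I_q}) :
  exists c C : R, [/\ 0 < c, 0 < C,
    non_lattice W ->
    exists (dO dB : measure_display) (Omega : measurableType dO)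
      (P : probability Omega R) (B : measurableType dB)
      (Y : int -> {RV P >-> B}) (F : (int -> B) -> (int -> 'I_q))
      (X : Omega -> int -> 'I_q),
      [/\ ffiid Y F X,
          {ae P, forall w, shift_ft W (X w)},
          measurable_fun [set: Omega] (radius Y F)
        & forall r : R, 0 < r ->
            (P [set w | (r%:E < radius Y F w)%E] <= ((tower (c * r))^-1)%:E)%E]
  & ~ has_constant W ->
    forall (dO dB : measure_display) (Omega : measurableType dO)
      (P : probability Omega R) (B : measurableType dB)
      (Y : int -> {RV P >-> B}) (F : (int -> B) -> (int -> 'I_q))
      (X : Omega -> int -> 'I_q),
      ffiid Y F X ->
      {ae P, forall w, shift_ft W (X w)} ->
      forall r : R, 0 < r ->
        prob_ge P [set w | (r%:E < radius Y F w)%E] (tower (C * r))^-1].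
Proof.
have [c c0 upper] : exists2 c : R, 0 < c & (non_lattice W -> tower_tail W c).
  have [nl|nl] := pselect (non_lattice W); last by exists 1.
  by have [c c0 cP] := tower_upper_bound R hq hk nl; exists c.
have [C C0 lower] : exists2 C : R, 0 < C & (~ has_constant W ->
    forall (dO dB : measure_display) (Omega : measurableType dO)
      (P : probability Omega R) (B : measurableType dB)
      (Y : int -> {RV P >-> B}) (F : (int -> B) -> (int -> 'I_q))
      (X : Omega -> int -> 'I_q),
      ffiid Y F X ->
      {ae P, forall w, shift_ft W (X w)} ->
      forall r : R, 0 < r ->
        prob_ge P [set w | (r%:E < radius Y F w)%E] (tower (C * r))^-1).
  have [hc|nc] := pselect (has_constant W); first by exists 1.
  by have [C C0 CP] := tower_lower_bound R hq hk nc; exists C.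
by exists c, C.
Qed.
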